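(* The contravariant functor $\mathcal{P}:\mathbf{SDS}\to\mathbf{OBD}$ is a full and faithful functor.
   Context: **Bratteli diagrams.** A Bratteli diagram $(V,E)$ consists of a vertex set $V=V_0\sqcup V_1\sqcup\cdots$ with each $V_n$ finite and non-empty and $V_0$ a singleton, and an edge set $E=E_1\sqcup E_2\sqcup\cdots$ with each $E_n$ finite and non-empty, together with maps $r,s:E\to V$ (range, source) such that $r(E_n)\subseteq V_n$, $s(E_n)\subseteq V_{n-1}$, $s^{-1}\{v\}\neq\varnothing$ for all $v\in V$ and $r^{-1}\{v\}\ne\varnothing$ for all $v\in V\setminus V_0$. An ordered Bratteli diagram $(V,E,\geq)$ is a Bratteli diagram with a partial order on $E$ such that $e,e'$ are comparable iff $r(e)=r(e')$. **Edge sets.** An ordered edge set from a finite set $S$ to a finite set $T$ is a finite set $F$ with maps $s:F\to S$, $r:F\to T$ and a linear order on each $r^{-1}\{w\}$, $w\in T$. If $G$ is an ordered edge set from $T$ to $U$, then $F\circ G=\{(e,g)\in F\times G: r(e)=s(g)\}$, with source $s(e)$, range $r(g)$, and order: for $r(g)=r(g')$, $(e,g)<(e',g')$ iff $g<g'$, or $g=g'$ and $e<e'$. Write $F\cong F'$ if there is a bijection $F\to F'$ preserving sources, ranges and order. For $k<l$, $E_{k,l}=E_{k+1}\circ\cdots\circ E_l$; $E_{k,k}$ consists of one edge from $v$ to $v$ for each $v\in V_k$. **The category $\mathbf{OBD}$.** Objects: ordered Bratteli diagrams. An ordered premorphism $f:B=(V,E,\ge)\to C=(W,S,\ge)$ is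 a triple $(F,(f_n)_{n\ge0},\geq)$ where $(f_n)$ is an unbounded sequence of integers with $0=f_0\le f_1\le\cdots$, and $F=F_0\sqcup F_1\sqcup\cdots$ where each $F_n$ is a non-empty finite ordered edge set from $V_n$ to $W_{f_n}$ such that every $v\in V_n$ is the source of some edge of $F_n$ (that is, $s^{-1}\{v\}\neq\varnothing$ for all $v\in V$) and every $w\in W_{f_n}$ is the range of some edge of $F_n$, $F_0$ is a singleton, and $E_{n+1}\circ F_{n+1}\cong F_n\circ S_{f_n,f_{n+1}}$ for all $n\ge0$. The composition of $f:B\to C$ and $g=(G,(g_n),\ge):C\to D$ is $gf=(H,(h_n),\ge)$ with $h_n=g_{f_n}$, $H_n=F_n\circ G_{f_n}$. Premorphisms $f,g:B\to C$ are equivalent if there are positive integers $n_1<m_1<n_2<m_2<\cdots$ with $f_{n_k}<g_{m_k}<f_{n_{k+1}}$ and, for all $k\ge1$, $E_{n_k,m_k}\circ G_{m_k}\cong F_{n_k}\circ S_{f_{n_k},g_{m_k}}$ and $E_{m_k,n_{k+1}}\circ F_{n_{k+1}}\cong G_{m_k}\circ S_{g_{m_k},f_{n_{k+1}}}$. Morphisms in $\mathbf{OBD}$ are equivalence classes $[f]$, with $[g][f]=[gf]$. **The category $\mathbf{SDS}$.** An essentially minimal totally disconnected dynamical system $(X,\varphi,x_0)$ consists of a metrizable compact totally disconnected space $X$, a homeomorphism $\varphi$ of $X$ such that $(X,\varphi)$ has a unique minimal (non-empty closed invariant) subset, and a point $x_0$ of that subset. A Kakutani–Rokhlin partition for it is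 a finite partition $P=\{Z(k,j): 1\le k\le K,\ 1\le j\le J(k)\}$ of $X$ into non-empty clopen sets with $\varphi(Z(k,j))=Z(k,j+1)$ for $1\le j<J(k)$, and such that the top $Z=\bigcup_kZ(k,J(k))$ contains $x_0$ and $\varphi(Z)=\bigcup_kZ(k,1)$; the sequences $(Z(k,1),\ldots,Z(k,J(k)))$ are its towers. A system of Kakutani–Rokhlin partitions is a sequence $\mathcal{R}=(P_n)_{n\ge0}$ of such partitions with $P_0=\{X\}$, $P_{n+1}$ refining $P_n$ (written $P_n\le P_{n+1}$), the tops $Z_n$ of $P_n$ ($n\ge1$) decreasing with intersection $\{x_0\}$, and $\bigcup_nP_n$ a basis for the topology of $X$. Objects of $\mathbf{SDS}$ are quadruples $(X,\varphi,x_0,\mathcal{R})$; morphisms $(X,\varphi,x_0,\mathcal{R})\to(Y,\psi,y_0,\mathcal{S})$ are continuous maps $\alpha:X\to Y$ with $\alpha\circ\varphi=\psi\circ\alpha$ and $\alpha(x_0)=y_0$. **The edge set $E(P,Q)$.** If $P\le Q$ are Kakutani–Rokhlin partitions and the top of $P$ contains the top of $Q$, $E(P,Q)$ is the set of triples $(S,T,k)$ with $S=(Z_1,\ldots,Z_n)$ a tower of $P$, $T=(Y_1,\ldots,Y_m)$ a tower of $Q$, $k\ge0$ an integer with $Y_{k+j}\subseteq Z_j$ for $1\le j\le n$; source $S$, range $T$, and $(S,T,k)\le(S',T',k')$ iff $T=T'$ and $k\le k'$. **The functor $\mathcal{P}$.** On objects with $\mathcal{R}=(P_n)$: $\mathcal{P}(X,\varphi,x_0,\mathcal{R})$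 has $V_n=\{(n,T): T\text{ a tower of }P_n\}$ and $E_n$ the copy $\{(n,S,T,k):(S,T,k)\in E(P_{n-1},P_n)\}$ of $E(P_{n-1},P_n)$ with its order. For a morphism $\alpha:(X,\varphi,x_0,(P_n))\to(Y,\psi,y_0,(Q_n))$, let $\alpha^{-1}(Q_n)$ be the set of inverse images of elements of $Q_n$, a Kakutani–Rokhlin partition for $(X,\varphi,x_0)$; for a tower $S=(Z_1,\ldots,Z_m)$ of $Q_n$ write $\alpha^{-1}(S)=(\alpha^{-1}(Z_1),\ldots,\alpha^{-1}(Z_m))$. Choose integers $0=f_0\le f_1\le\cdots$, unbounded, with $\alpha^{-1}(Q_n)\le P_{f_n}$ and the top of $\alpha^{-1}(Q_n)$ containing the top of $P_{f_n}$; let $F_n=\{(n,S,T,k):(\alpha^{-1}(S),T,k)\in E(\alpha^{-1}(Q_n),P_{f_n})\}$ with source $(n,S)$, range $(f_n,T)$ and the induced order ($F_0$ a single edge). Then $f=(\bigsqcup F_n,(f_n),\ge)$ is an ordered premorphism $\mathcal{P}(Y,\psi,y_0,(Q_n))\to\mathcal{P}(X,\varphi,x_0,(P_n))$ and $\mathcal{P}(\alpha)=[f]$.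
   Formalization: Morphisms of SDS are additionally required to be surjective; for a non-surjective map some cell of some Q_n has empty preimage, so its tower is the source of no edge of F_n and P(α) is not a premorphism. *)

(* Defs.v *)
From mathcomp Require Import all_boot finmap.
From mathcomp Require Import boolp classical_sets reals topology.

Set Implicit Arguments.
Unset Strict Implicit.
Unset Printing Implicit Defensive.

Local Open Scope classical_set_scope.

Record category := Category {
  ob :> Type;
  hom : ob -> ob -> Type;
  idm : forall A, hom A A;
  compm : forall A B C, hom B C -> hom A B -> hom A C;
  comp1m : forall A B (f : hom A B), compm (idm B) f = f;
  compm1 : forall A B (f : hom A B), compm f (idm A) = f;
  compmA : forall A B C D (h : hom C D) (g : hom B C) (f : hom A B),
    compm h (compm g f) = compm (compm h g) f }.

Arguments hom {_} _ _.
Arguments idm {_} _.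
Arguments compm {_ _ _ _} _ _.

Record contrafunctor (C D : category) (F0 : C -> D) := ContraFunctor {
  fmap :> forall A B : C, hom A B -> hom (F0 B) (F0 A);
  fmap_id : forall A : C, fmap (idm A) = idm (F0 A);
  fmap_comp : forall (A B B' : C) (g : hom B B') (f : hom A B),
    fmap (compm g f) = compm (fmap f) (fmap g) }.

Arguments fmap {_ _ _} _ {_ _} _.

Definition faithful (C D : category) (F0 : C -> D) (F : contrafunctor F0) :=
  forall (A B : C) (f g : hom A B), fmap F f = fmap F g -> f = g.

Definition full (C D : category) (F0 : C -> D) (F : contrafunctor F0) :=
  forall (A B : C) (h : hom (F0 B) (F0 A)), exists f : hom A B, fmap F f = h.

(* The linear orders on the fibres r^-1(w) are packaged as one partial order on
   the edges, in which two edges are comparable iff they have the same range. *)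
Record edge_set (S T : finType) := EdgeSet {
  edge :> finType;
  src : edge -> S;
  rng : edge -> T;
  ele : rel edge;
  ele_refl : reflexive ele;
  ele_anti : antisymmetric ele;
  ele_trans : transitive ele;
  ele_cmp : forall e e', (ele e e' || ele e' e) = (rng e == rng e') }.

Definition eiso (S T : finType) (F G : edge_set S T) : Prop :=
  exists h : F -> G, [/\ bijective h, forall e, src (h e) = src e,
    forall e, rng (h e) = rng e & forall e e', ele (h e) (h e') = ele e e'].

Section Composition.
Variables (S T U : finType) (F : edge_set S T) (G : edge_set T U).

Definition ecomp_edge := {p : F * G | rng p.1 == src p.2}.

Definition ecomp_le : rel ecomp_edge := fun p q =>
  ((val p).2 != (val q).2) && ele (val p).2 (val q).2
  || ((val p).2 == (val q).2) && ele (val p).1 (val q).1.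

Lemma ecomp_le_refl : reflexive ecomp_le.
Proof. by move=> p; rewrite /ecomp_le !eqxx /= ele_refl. Qed.

Lemma ecomp_le_anti : antisymmetric ecomp_le.
Proof.
move=> [[e g] /= i] [[e' g'] /= i']; rewrite /ecomp_le /= => H.
apply/val_inj => /=; move: H; rewrite (eq_sym g').
case: (eqVneq g g') => [->|ne] /=; last first.
  by rewrite !orbF => /ele_anti E; rewrite E eqxx in ne.
by move/ele_anti => ->.
Qed.

Lemma ecomp_le_trans : transitive ecomp_le.
Proof.
move=> [[e2 g2] /= i2] [[e1 g1] /= i1] [[e3 g3] /= i3]; rewrite /ecomp_le /=.
case: (eqVneq g1 g2) => [->|n12] /=.
  by case: (eqVneq g2 g3) => //= _; apply: ele_trans.
rewrite orbF; case: (eqVneq g2 g3) => [<-|n23] /=; first by rewrite n12 => ->.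
rewrite orbF => h12 h23; case: (eqVneq g1 g3) => [E|n13] /=; last first.
  by rewrite (ele_trans h12 h23).
have := @ele_anti _ _ G g1 g2; rewrite h12 E h23 => /(_ isT) E2.
by rewrite E E2 eqxx in n12.
Qed.

Lemma ecomp_le_cmp p q :
  (ecomp_le p q || ecomp_le q p) = (rng (val p).2 == rng (val q).2).
Proof.
case: p q => [[e g] /= i] [[e' g'] /= i']; rewrite /ecomp_le /= (eq_sym g' g).
case: (eqVneq g g') => [E|ne] /=; last by rewrite !orbF ele_cmp.
by rewrite ele_cmp (eqP i) (eqP i') E !eqxx.
Qed.

Definition ecomp : edge_set S U :=
  @EdgeSet S U ecomp_edge (fun p => src (val p).1) (fun p => rng (val p).2)
    ecomp_le ecomp_le_refl ecomp_le_anti ecomp_le_trans ecomp_le_cmp.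

Definition epair (e : F) (g : G) (i : rng e == src g) : ecomp :=
  exist _ (e, g) i.

End Composition.

Notation "F \oe G" := (ecomp F G) (at level 40, left associativity).

Record bratteli := Bratteli {
  vtx : nat -> finType;
  (* [bedge n] is the set E_{n+1} of edges from V_n to V_{n+1}. *)
  bedge : forall n, edge_set (vtx n) (vtx n.+1);
  vtx_nonempty : forall n, (0 < #|vtx n|)%N;
  vtx0 : #|vtx 0| = 1;
  bedge_nonempty : forall n, (0 < #|bedge n|)%N;
  bedge_src : forall n (v : vtx n), exists e : bedge n, src e = v;
  bedge_rng : forall n (v : vtx n.+1), exists e : bedge n, rng e = v }.

(* [diag_edges V k l] has one edge from v to v for each v : V k when k = l,
   and no edge otherwise; allowing k <> l avoids transports along k = l. *)
Section Diagonal.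
Variables (V : nat -> finType) (k l : nat).

Definition diag_edge := {p : V k * V l | Tagged V p.1 == Tagged V p.2}.

Lemma diag_le_cmp (p q : diag_edge) :
  (p == q) || (q == p) = ((val p).2 == (val q).2).
Proof.
rewrite (eq_sym q) orbb.
apply/eqP/eqP => [-> //|]; case: p q => [[a b] /= i] [[a' b'] /= i'] E.
subst b'; have: Tagged V a == Tagged V a' by rewrite (eqP i) (eqP i').
by rewrite eq_Tagged /= => /eqP Ea; apply/val_inj; rewrite /= Ea.
Qed.

Lemma diag_le_anti : antisymmetric (fun p q : diag_edge => p == q).
Proof. by move=> p q /andP[/eqP]. Qed.

Lemma diag_le_trans : transitive (fun p q : diag_edge => p == q).
Proof. by move=> p q r /eqP ->. Qed.

Definition diag_edges : edge_set (V k) (V l) :=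
  @EdgeSet _ _ diag_edge (fun p => (val p).1) (fun p => (val p).2)
    (fun p q => p == q) (fun p => eqxx p) diag_le_anti diag_le_trans diag_le_cmp.

Definition dpair (a : V k) (b : V l) (i : Tagged V a == Tagged V b) :
  diag_edges := exist _ (a, b) i.

End Diagonal.

(* E_{k,l}; only used for k <= l. *)
Fixpoint bpath (B : bratteli) (k l : nat) : edge_set (vtx B k) (vtx B l) :=
  match l with
  | 0 => diag_edges (vtx B) k 0
  | l'.+1 => if (k <= l')%N then bpath B k l' \oe bedge B l'
             else diag_edges (vtx B) k l'.+1
  end.

Record is_premorphism (B C : bratteli) (f : nat -> nat)
    (F : forall n, edge_set (vtx B n) (vtx C (f n))) : Prop := IsPremorphism {
  pm0 : f 0 = 0;
  pm_mono : forall n, (f n <= f n.+1)%N;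
  pm_unbounded : forall N, exists n, (N <= f n)%N;
  pm_nonempty : forall n, (0 < #|F n|)%N;
  pm_src : forall n (v : vtx B n), exists e : F n, src e = v;
  pm_rng : forall n (w : vtx C (f n)), exists e : F n, rng e = w;
  pm_card0 : #|F 0| = 1;
  pm_comm : forall n,
    eiso (bedge B n \oe F n.+1) (F n \oe bpath C (f n) (f n.+1)) }.

Record premorphism (B C : bratteli) := Premorphism {
  pidx : nat -> nat;
  pedge : forall n, edge_set (vtx B n) (vtx C (pidx n));
  premorphismP : is_premorphism pedge }.

Definition pequiv (B C : bratteli) (f g : premorphism B C) : Prop :=
  exists n m : nat -> nat, forall k,
  [/\ [/\ (0 < n k)%N, (n k < m k)%N & (m k < n k.+1)%N],
      (pidx f (n k) < pidx g (m k))%N,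
      (pidx g (m k) < pidx f (n k.+1))%N,
      eiso (bpath B (n k) (m k) \oe pedge g (m k))
           (pedge f (n k) \oe bpath C (pidx f (n k)) (pidx g (m k))) &
      eiso (bpath B (m k) (n k.+1) \oe pedge f (n k.+1))
           (pedge g (m k) \oe bpath C (pidx g (m k)) (pidx f (n k.+1)))].

Section Eiso.
Variables S T : finType.
Implicit Types F G H : edge_set S T.

Lemma eiso_refl F : eiso F F.
Proof. by exists id; split=> //; exists id. Qed.

Lemma eiso_sym F G : eiso F G -> eiso G F.
Proof.
case=> h [[k hk kh] hs hr hl]; exists k; split.
- by exists h.
- by move=> e; rewrite -{2}(kh e) hs.
- by move=> e; rewrite -{2}(kh e) hr.
- by move=> e e'; rewrite -{2}(kh e) -{2}(kh e') hl.
Qed.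

Lemma eiso_trans F G H : eiso F G -> eiso G H -> eiso F H.
Proof.
case=> h [bh hs hr hl] [k [bk ks kr kl]]; exists (k \o h); split.
- exact: bij_comp.
- by move=> e /=; rewrite ks hs.
- by move=> e /=; rewrite kr hr.
- by move=> e e' /=; rewrite kl hl.
Qed.

End Eiso.

Lemma eiso_comp (S T U : finType) (F F' : edge_set S T) (G G' : edge_set T U) :
  eiso F F' -> eiso G G' -> eiso (F \oe G) (F' \oe G').
Proof.
move=> [h [[h' hK h'K] hs hr hl]] [k [[k' kK k'K] ks kr kl]].
have P1 (p : F \oe G) : rng (h (val p).1) == src (k (val p).2).
  by rewrite hr ks (valP p).
have P2 (p : F' \oe G') : rng (h' (val p).1) == src (k' (val p).2).
  by rewrite -hr -ks h'K k'K (valP p).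
exists (fun p => epair (P1 p)); split.
- exists (fun p => epair (P2 p)).
    by move=> [[e g] i]; apply/val_inj; rewrite /= hK kK.
  by move=> [[e g] i]; apply/val_inj; rewrite /= h'K k'K.
- by move=> p; apply: hs.
- by move=> p; apply: kr.
- move=> [[e g] i] [[e' g'] i']; rewrite /= /ecomp_le /= kl hl.
  by rewrite (inj_eq (can_inj kK)).
Qed.

Lemma eiso_compl (S T U : finType) (F F' : edge_set S T) (G : edge_set T U) :
  eiso F F' -> eiso (F \oe G) (F' \oe G).
Proof. by move=> i; apply: eiso_comp i (eiso_refl _). Qed.

Lemma eiso_compr (S T U : finType) (F : edge_set S T) (G G' : edge_set T U) :
  eiso G G' -> eiso (F \oe G) (F \oe G').
Proof. by move=> i; apply: eiso_comp (eiso_refl _) i. Qed.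

Lemma eiso_assoc (S T U W : finType) (F : edge_set S T) (G : edge_set T U)
    (H : edge_set U W) : eiso (F \oe G \oe H) (F \oe (G \oe H)).
Proof.
pose P1 (p : F \oe G \oe H) : G \oe H :=
  @epair _ _ _ G H (val (val p).1).2 (val p).2 (valP p).
pose P2 (p : F \oe G \oe H) : F \oe (G \oe H) :=
  @epair _ _ _ F (G \oe H) (val (val p).1).1 (P1 p) (valP (val p).1).
pose Q1 (p : F \oe (G \oe H)) : F \oe G :=
  @epair _ _ _ F G (val p).1 (val (val p).2).1 (valP p).
pose Q2 (p : F \oe (G \oe H)) : F \oe G \oe H :=
  @epair _ _ _ (F \oe G) H (Q1 p) (val (val p).2).2 (valP (val p).2).
exists P2; split.
- exists Q2.
    move=> [[[[e g] i] h] j]; apply/val_inj => /=; congr pair.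
    exact: val_inj.
  move=> [[e [[g h] i]] j]; apply/val_inj => /=; congr pair.
  exact: val_inj.
- by [].
- by [].
- move=> [[[[e g] i] h] j] [[[[e' g'] i'] h'] j'].
  rewrite /= /ecomp_le /= /ecomp_le /= -[_ == exist _ (g', h') _]val_eqE /=.
  rewrite xpair_eqE.
  by case: (h == h'); case: (g == g'); rewrite ?andbF ?orbF ?andbT.
Qed.

Lemma eiso_diagl (V : nat -> finType) k (T : finType) (F : edge_set (V k) T) :
  eiso (diag_edges V k k \oe F) F.
Proof.
have D (p : diag_edges V k k) : src p = rng p.
  by case: p => [[a b] /=]; rewrite eq_Tagged => /eqP.
pose P1 (e : F) : diag_edges V k k := dpair (eqxx (Tagged V (src e))).
pose P2 (e : F) : diag_edges V k k \oe F := @epair _ _ _ _ F (P1 e) e (eqxx _).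
exists (fun p => (val p).2); split.
- exists P2 => //.
  move=> [[d e] i]; apply/val_inj => /=; congr pair; apply/val_inj => /=.
  by move: i (D d) => /= /eqP; case: d => [[a b] j] /= -> ->.
- by move=> [[d e] i] /=; rewrite [RHS]D (eqP i).
- by [].
- move=> [[d e] i] [[d' e'] i'] /=; rewrite /ecomp_le /=.
  case: (eqVneq e e') => [E|_] /=; last by rewrite orbF.
  subst e'; rewrite ele_refl; symmetry; apply/eqP/val_inj => /=.
  move: (i) (i') (D d) (D d') => /= /eqP + /eqP.
  by case: d {i} => [[a b] j]; case: d' {i'} => [[a' b'] j'] /= -> -> -> ->.
Qed.

Lemma eiso_diagr (V : nat -> finType) k (S : finType) (F : edge_set S (V k)) :
  eiso (F \oe diag_edges V k k) F.
Proof.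
have D (p : diag_edges V k k) : src p = rng p.
  by case: p => [[a b] /=]; rewrite eq_Tagged => /eqP.
pose P1 (e : F) : diag_edges V k k := dpair (eqxx (Tagged V (rng e))).
pose P2 (e : F) : F \oe diag_edges V k k := @epair _ _ _ F _ e (P1 e) (eqxx _).
exists (fun p => (val p).1); split.
- exists P2 => //.
  move=> [[e d] i]; apply/val_inj => /=; congr pair; apply/val_inj => /=.
  by move: i (D d) => /= /eqP; case: d => [[a b] j] /= -> ->.
- by [].
- by move=> [[e d] i] /=; rewrite [LHS](eqP i) D.
- move=> [[e d] i] [[e' d'] i'] /=; rewrite /ecomp_le /=.
  have -> : (d == d' :> diag_edge _ _ _) = (rng e == rng e').
    rewrite (eqP i) (eqP i'); apply/eqP/eqP => [-> //|E].
    apply/val_inj => /=; move: E (D d) (D d').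
    by case: d {i} => [[a b] j]; case: d' {i'} => [[a' b'] j'] /= -> -> ->.
  by rewrite andNb /= -ele_cmp andbC; case: (ele e e').
Qed.

Section Paths.
Variable B : bratteli.

Lemma bpath_id k : bpath B k k = diag_edges (vtx B) k k.
Proof. by case: k => //= k; rewrite ltnn. Qed.

Lemma bpathS k l : (k <= l)%N -> bpath B k l.+1 = bpath B k l \oe bedge B l.
Proof. by move=> /= ->. Qed.

Lemma bpath_comp k l m : (k <= l)%N -> (l <= m)%N ->
  eiso (bpath B k l \oe bpath B l m) (bpath B k m).
Proof.
move=> kl; elim: m => [|m IH] lm.
  by move: kl; move: lm; rewrite leqn0 => /eqP -> _; rewrite bpath_id; apply: eiso_diagr.
move: lm; rewrite leq_eqVlt => /predU1P[->|]; first by rewrite bpath_id; apply: eiso_diagr.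
rewrite ltnS => lm; rewrite !bpathS //; last exact: leq_trans lm.
by apply: eiso_trans (eiso_sym (eiso_assoc _ _ _)) (eiso_compl _ (IH lm)).
Qed.

Lemma bpath1 k : eiso (bpath B k k.+1) (bedge B k).
Proof. by rewrite bpathS // bpath_id; apply: eiso_diagl. Qed.

End Paths.

Section Premorphisms.
Variables B C : bratteli.

Lemma pidx_mono (f : premorphism B C) : {homo pidx f : k l / (k <= l)%N}.
Proof. exact: homo_leq leqnn leq_trans (pm_mono (premorphismP f)). Qed.

Lemma pm_path (f : premorphism B C) k l : (k <= l)%N ->
  eiso (bpath B k l \oe pedge f l)
       (pedge f k \oe bpath C (pidx f k) (pidx f l)).
Proof.
elim: l => [|l IH].
  rewrite leqn0 => /eqP ->; rewrite !bpath_id.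
  exact: eiso_trans (eiso_diagl _) (eiso_sym (eiso_diagr _)).
rewrite leq_eqVlt => /predU1P[->|].
  rewrite !bpath_id.
  exact: eiso_trans (eiso_diagl _) (eiso_sym (eiso_diagr _)).
rewrite ltnS => kl; rewrite bpathS //.
apply: eiso_trans (eiso_assoc _ _ _) _.
apply: eiso_trans (eiso_compr _ (pm_comm (premorphismP f) l)) _.
apply: eiso_trans (eiso_sym (eiso_assoc _ _ _)) _.
apply: eiso_trans (eiso_compl _ (IH kl)) _.
apply: eiso_trans (eiso_assoc _ _ _) (eiso_compr _ _).
by apply: bpath_comp; apply: pidx_mono.
Qed.

(* A half of the zigzag condition, as a relation between levels. *)
Definition plink (f g : premorphism B C) n m : Prop :=
  eiso (bpath B n m \oe pedge g m)
       (pedge f n \oe bpath C (pidx f n) (pidx g m)).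

Lemma plink_extr f g n m m' : (n <= m)%N -> (m <= m')%N ->
  (pidx f n <= pidx g m)%N -> plink f g n m -> plink f g n m'.
Proof.
move=> nm mm' le l; rewrite /plink.
apply: eiso_trans (eiso_compl _ (eiso_sym (bpath_comp _ nm mm'))) _.
apply: eiso_trans (eiso_assoc _ _ _) _.
apply: eiso_trans (eiso_compr _ (pm_path _ mm')) _.
apply: eiso_trans (eiso_sym (eiso_assoc _ _ _)) _.
apply: eiso_trans (eiso_compl _ l) _.
apply: eiso_trans (eiso_assoc _ _ _) (eiso_compr _ _).
by apply: bpath_comp => //; apply: pidx_mono.
Qed.

Lemma plink_extl f g n n' m : (n' <= n)%N -> (n <= m)%N ->
  (pidx f n <= pidx g m)%N -> plink f g n m -> plink f g n' m.
Proof.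
move=> n'n nm le l; rewrite /plink.
apply: eiso_trans (eiso_compl _ (eiso_sym (bpath_comp _ n'n nm))) _.
apply: eiso_trans (eiso_assoc _ _ _) _.
apply: eiso_trans (eiso_compr _ l) _.
apply: eiso_trans (eiso_sym (eiso_assoc _ _ _)) _.
apply: eiso_trans (eiso_compl _ (pm_path _ n'n)) _.
apply: eiso_trans (eiso_assoc _ _ _) (eiso_compr _ _).
by apply: bpath_comp => //; apply: pidx_mono.
Qed.

Lemma plink_trans f g h n m p : (n <= m)%N -> (m <= p)%N ->
  (pidx f n <= pidx g m)%N -> (pidx g m <= pidx h p)%N ->
  plink f g n m -> plink g h m p -> plink f h n p.
Proof.
move=> nm mp le1 le2 l1 l2; rewrite /plink.
apply: eiso_trans (eiso_compl _ (eiso_sym (bpath_comp _ nm mp))) _.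
apply: eiso_trans (eiso_assoc _ _ _) _.
apply: eiso_trans (eiso_compr _ l2) _.
apply: eiso_trans (eiso_sym (eiso_assoc _ _ _)) _.
apply: eiso_trans (eiso_compl _ l1) _.
apply: eiso_trans (eiso_assoc _ _ _) (eiso_compr _ _).
exact: bpath_comp.
Qed.

Definition plinks (f g : premorphism B C) : Prop :=
  forall n, exists2 M, (n <= M)%N /\ (pidx f n <= pidx g M)%N &
    forall m, (M <= m)%N -> plink f g n m.

Lemma plinks_large f g n N : plinks f g ->
  exists m, [/\ (N <= m)%N, (n < m)%N, (pidx f n < pidx g m)%N & plink f g n m].
Proof.
move=> /(_ n)[M _ H].
have [p pP] := pm_unbounded (premorphismP g) (pidx f n).+1.
exists (maxn (maxn N n.+1) (maxn M p)); split.
- by rewrite !leq_max leqnn.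
- by rewrite !leq_max leqnn !orbT.
- by apply: leq_trans pP _; apply: pidx_mono; rewrite !leq_max leqnn !orbT.
- by apply: H; rewrite !leq_max leqnn !orbT.
Qed.

Lemma pequivP f g : pequiv f g <-> plinks f g /\ plinks g f.
Proof.
split=> [[n [m H]]|[Hfg Hgf]].
  have n_gt k : (k < n k)%N.
    elim: k => [|k IH]; first by case: (H 0) => -[].
    case: (H k) => -[_ a b] _ _ _ _.
    exact: leq_ltn_trans IH (ltn_trans a b).
  split=> k; case: (H k) => -[_ nm mn] lfg lgf i j.
    have km : (k <= n k)%N by apply/ltnW/n_gt.
    exists (m k); first split.
    - exact: leq_trans km (ltnW nm).
    - by apply: leq_trans (ltnW lfg); apply: pidx_mono.
    - move=> m' mm'; apply: (plink_extl km).
      + exact: leq_trans (ltnW nm) mm'.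
      + by apply: leq_trans (ltnW lfg) _; apply: pidx_mono.
      + exact: (plink_extr (ltnW nm) mm' (ltnW lfg)).
  have km : (k <= m k)%N by apply: leq_trans (ltnW nm); apply/ltnW/n_gt.
  exists (n k.+1); first split.
  - exact: leq_trans km (ltnW mn).
  - by apply: leq_trans (ltnW lgf); apply: pidx_mono.
  - move=> m' mm'; apply: (plink_extl km).
    + exact: leq_trans (ltnW mn) mm'.
    + by apply: leq_trans (ltnW lgf) _; apply: pidx_mono.
    + exact: (plink_extr (ltnW mn) mm' (ltnW lgf)).
have /choice[u uP] : forall n, exists m, [/\ (0 < m)%N, (n < m)%N,
    (pidx f n < pidx g m)%N & plink f g n m].
  by move=> n; apply: plinks_large.
have /choice[v vP] : forall n, exists m, [/\ (0 < m)%N, (n < m)%N,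
    (pidx g n < pidx f m)%N & plink g f n m].
  by move=> n; apply: plinks_large.
pose n := fix n k := if k is k'.+1 then v (u (n k')) else 1.
exists n, (fun k => u (n k)) => k /=.
case: (uP (n k)) => _ u2 u3 u4; case: (vP (u (n k))) => _ v2 v3 v4.
split=> //; split=> //.
by case: (k) => //= k'; case: (vP (u (n k'))).
Qed.

Lemma pequiv_refl (f : premorphism B C) : pequiv f f.
Proof.
by apply/pequivP; split=> n; exists n => // m nm; apply: pm_path.
Qed.

Lemma pequiv_sym (f g : premorphism B C) : pequiv f g -> pequiv g f.
Proof. by move=> /pequivP[? ?]; apply/pequivP. Qed.

Lemma plinks_trans f g h : plinks f g -> plinks g h -> plinks f h.
Proof.
move=> H1 H2 n; have [m [_ nm le1 l1]] := plinks_large n 0 H1.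
have [p [_ mp le2 l2]] := plinks_large m 0 H2.
have np := ltn_trans nm mp; have le := ltn_trans le1 le2.
exists p; first by split; apply: ltnW.
move=> q pq; apply: (plink_extr (ltnW np) pq (ltnW le)).
exact: (plink_trans (ltnW nm) (ltnW mp) (ltnW le1) (ltnW le2) l1 l2).
Qed.

Lemma pequiv_trans (f g h : premorphism B C) : pequiv f g -> pequiv g h -> pequiv f h.
Proof.
move=> /pequivP[a b] /pequivP[c d]; apply/pequivP; split.
  exact: plinks_trans a c.
exact: plinks_trans d b.
Qed.

Lemma pequiv_iso (s : nat -> nat) (F G : forall n, edge_set (vtx B n) (vtx C (s n)))
    (pF : is_premorphism F) (pG : is_premorphism G) :
  (forall n, eiso (F n) (G n)) -> pequiv (Premorphism pF) (Premorphism pG).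
Proof.
move=> i; set f := Premorphism pF; set g := Premorphism pG.
have fg n m : (n <= m)%N -> plink f g n m.
  move=> nm; apply: eiso_trans (eiso_compr _ (eiso_sym (i m))) _.
  exact: (pm_path f).
have gf n m : (n <= m)%N -> plink g f n m.
  move=> nm; apply: eiso_trans (eiso_compr _ (i m)) _.
  exact: (pm_path g).
by apply/pequivP; split=> n; exists n => // m; [apply: fg|apply: gf].
Qed.

End Premorphisms.

Lemma pid_subproof (B : bratteli) :
  @is_premorphism B B id (fun n => diag_edges (vtx B) n n).
Proof.
pose D n (v : vtx B n) : diag_edges (vtx B) n n := dpair (eqxx (Tagged (vtx B) v)).
have Dc n : #|diag_edges (vtx B) n n| = #|vtx B n|.
  apply: (bij_eq_card (f := fun p : diag_edges (vtx B) n n => src p)).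
  exists (@D n) => //.
  by move=> [[a b] /= i]; apply/val_inj => /=; move: i; rewrite eq_Tagged => /eqP /= ->.
split=> //.
- by move=> N; exists N.
- by move=> n; rewrite Dc vtx_nonempty.
- by move=> n v; exists (D n v).
- by move=> n v; exists (D n v).
- by rewrite Dc vtx0.
- move=> n; apply: eiso_trans (eiso_diagr _) _.
  exact: eiso_trans (eiso_sym (bpath1 B n)) (eiso_sym (eiso_diagl _)).
Qed.

Definition pid (B : bratteli) : premorphism B B := Premorphism (pid_subproof B).

Lemma pcomp_subproof (B C D : bratteli) (g : premorphism C D) (f : premorphism B C) :
  @is_premorphism B D (fun n => pidx g (pidx f n))
    (fun n => pedge f n \oe pedge g (pidx f n)).
Proof.
have srcP n (v : vtx B n) : exists e : pedge f n \oe pedge g (pidx f n), src e = v.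
  have [e ev] := pm_src (premorphismP f) v.
  have [e' /eqP] := pm_src (premorphismP g) (rng e).
  by rewrite eq_sym => i; exists (epair i).
split=> //.
- by rewrite (pm0 (premorphismP f)) (pm0 (premorphismP g)).
- by move=> n; apply: pidx_mono; apply: (pm_mono (premorphismP f)).
- move=> N; have [m mP] := pm_unbounded (premorphismP g) N.
  have [n nP] := pm_unbounded (premorphismP f) m.
  by exists n; apply: leq_trans mP _; apply: pidx_mono.
- move=> n; have /card_gt0P[v _] := vtx_nonempty B n.
  by have [e _] := srcP n v; apply/card_gt0P; exists e.
- move=> n w; have [e' ew] := pm_rng (premorphismP g) w.
  have [e /eqP i] := pm_rng (premorphismP f) (src e').
  by exists (epair i).
- have := pm_card0 (premorphismP f); have := pm_card0 (premorphismP g).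
  have f0 := pm0 (premorphismP f).
  move: (pedge f 0); rewrite f0 => F0 /eqP/fintype1P/cid[e' E'] /eqP/fintype1P/cid[e E].
  have v0 (v w : vtx C 0) : v = w.
    have /eqP/fintype1P[x X] := vtx0 C; by rewrite (X v) (X w).
  have i : rng e == src e' by apply/eqP/v0.
  apply/eqP/fintype1P; exists (epair i) => -[[a b] j].
  by apply/val_inj; rewrite /= (E a) (E' b).
- move=> n; apply: eiso_trans (eiso_sym (eiso_assoc _ _ _)) _.
  apply: eiso_trans (eiso_compl _ (pm_comm (premorphismP f) n)) _.
  apply: eiso_trans (eiso_assoc _ _ _) _.
  apply: eiso_trans (eiso_compr _ (pm_path g (pm_mono (premorphismP f) n))) _.
  exact: eiso_sym (eiso_assoc _ _ _).
Qed.

Definition pcomp (B C D : bratteli) (g : premorphism C D) (f : premorphism B C) :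
  premorphism B D := Premorphism (pcomp_subproof g f).

Lemma plinks_pcomp (B C D : bratteli) (g g' : premorphism C D)
    (f f' : premorphism B C) :
  plinks f f' -> plinks g g' -> plinks (pcomp g f) (pcomp g' f').
Proof.
move=> Hf Hg n.
have [M [nM leM] HM] := Hf n.
have [N [fN leN] HN] := Hg (pidx f n).
have [p pP] := pm_unbounded (premorphismP f') N.
have pM m : (maxn M p <= m)%N -> [/\ (pidx f n <= pidx f' m)%N, (N <= pidx f' m)%N &
    (pidx g (pidx f n) <= pidx g' (pidx f' m))%N].
  rewrite geq_max => /andP[Mm pm].
  have Nm : (N <= pidx f' m)%N by apply: leq_trans pP _; apply: pidx_mono.
  split=> //; first by apply: leq_trans leM _; apply: pidx_mono.
  by apply: leq_trans leN _; apply: pidx_mono.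
exists (maxn M p).
  split; first by rewrite leq_max nM.
  by have [] := pM _ (leqnn _).
move=> m mP; have [l1 l2 l3] := pM m mP.
have Mm : (M <= m)%N by move: mP; rewrite geq_max => /andP[].
rewrite /plink /=.
apply: eiso_trans (eiso_sym (eiso_assoc _ _ _)) _.
apply: eiso_trans (eiso_compl _ (HM m Mm)) _.
apply: eiso_trans (eiso_assoc _ _ _) _.
apply: eiso_trans (eiso_compr _ (HN _ l2)) _.
exact: eiso_sym (eiso_assoc _ _ _).
Qed.

Lemma pequiv_pcomp (B C D : bratteli) (g g' : premorphism C D)
    (f f' : premorphism B C) :
  pequiv f f' -> pequiv g g' -> pequiv (pcomp g f) (pcomp g' f').
Proof.
move=> /pequivP[a b] /pequivP[c d]; apply/pequivP.
by split; apply: plinks_pcomp.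
Qed.

Definition pclass (B C : bratteli) (f g : premorphism B C) : Prop := pequiv f g.

Definition obd_hom (B C : bratteli) :=
  {c : premorphism B C -> Prop | exists f, c = pclass f}.

Definition obd_class (B C : bratteli) (f : premorphism B C) : obd_hom B C :=
  exist _ (pclass f) (ex_intro _ f erefl).

Definition obd_repr (B C : bratteli) (c : obd_hom B C) : premorphism B C :=
  projT1 (cid (projT2 c)).

Lemma obd_reprK (B C : bratteli) (c : obd_hom B C) : obd_class (obd_repr c) = c.
Proof.
case: c => c H; rewrite /obd_repr /=; case: (cid _) => f /= E.
by apply: eq_exist; rewrite E.
Qed.

Lemma obd_classP (B C : bratteli) (f g : premorphism B C) :
  obd_class f = obd_class g <-> pequiv f g.
Proof.
split=> [[E]|fg].
  have : pclass g g by apply: pequiv_refl.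
  by rewrite -E.
apply: eq_exist; apply/predeqP => h; split; rewrite /pclass /=.
  exact: pequiv_trans (pequiv_sym fg).
exact: pequiv_trans.
Qed.

Definition obd_comp (B C D : bratteli) (d : obd_hom C D) (c : obd_hom B C) :
  obd_hom B D := obd_class (pcomp (obd_repr d) (obd_repr c)).

Lemma obd_compE (B C D : bratteli) (g : premorphism C D) (f : premorphism B C) :
  obd_comp (obd_class g) (obd_class f) = obd_class (pcomp g f).
Proof.
by apply/obd_classP/pequiv_pcomp; apply/obd_classP; rewrite obd_reprK.
Qed.

Lemma obd_comp1m (B C : bratteli) (c : obd_hom B C) :
  obd_comp (obd_class (pid C)) c = c.
Proof.
rewrite -(obd_reprK c) obd_compE; apply/obd_classP.
case: (obd_repr c) => s F pF; apply: pequiv_iso => n; exact: eiso_diagr.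
Qed.

Lemma obd_compm1 (B C : bratteli) (c : obd_hom B C) :
  obd_comp c (obd_class (pid B)) = c.
Proof.
rewrite -(obd_reprK c) obd_compE; apply/obd_classP.
case: (obd_repr c) => s F pF; apply: pequiv_iso => n; exact: eiso_diagl.
Qed.

Lemma obd_compmA (A B C D : bratteli) (h : obd_hom C D) (g : obd_hom B C)
    (f : obd_hom A B) :
  obd_comp h (obd_comp g f) = obd_comp (obd_comp h g) f.
Proof.
rewrite -(obd_reprK h) -(obd_reprK g) -(obd_reprK f) !obd_compE.
apply/obd_classP; apply: pequiv_iso => n; exact: eiso_assoc.
Qed.

Definition OBD : category :=
  @Category bratteli obd_hom (fun B => obd_class (pid B)) obd_comp
    obd_comp1m obd_compm1 obd_compmA.

Definition homeomorphism (X Y : topologicalType) (h : X -> Y) : Prop :=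
  continuous h /\ exists g : Y -> X, [/\ continuous g, cancel h g & cancel g h].

Definition metrizable (R : realType) (X : topologicalType) : Prop :=
  exists (M : metricType R) (h : X -> M), homeomorphism h.

Definition minimal (X : topologicalType) (phi : X -> X) (A : set X) : Prop :=
  [/\ A !=set0, closed A, phi @` A = A &
      forall B : set X, B !=set0 -> closed B -> phi @` B = B -> B `<=` A -> B = A].

Record em_system (R : realType) := EMSystem {
  space :> topologicalType;
  dyn : space -> space;
  pt : space;
  em_metrizable : metrizable R space;
  em_compact : compact [set: space];
  em_disconnected : totally_disconnected [set: space];
  em_homeo : homeomorphism dyn;
  em_minimal : exists2 A, minimal dyn A & A pt /\ forall B, minimal dyn B -> B = A }.

Section KakutaniRokhlin.
Variables (X : topologicalType) (phi : X -> X) (x0 : X).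

(* A tower (Z(k,1),...,Z(k,J(k))) is a sequence of subsets of X, indexed here
   from 0.  The towers are part of the data of the partition, since the same
   clopen sets may be arranged into towers in several ways. *)
Definition cells (P : {fset seq (set X)}) : set (set X) :=
  [set Z | exists2 S, S \in P & Z \in S].

Definition top (P : {fset seq (set X)}) : set X :=
  [set x | exists2 S, S \in P & last set0 S x].

Definition base (P : {fset seq (set X)}) : set X :=
  [set x | exists2 S, S \in P & head set0 S x].

Record is_KR (P : {fset seq (set X)}) : Prop := IsKR {
  kr_height : forall S, S \in P -> (0 < size S)%N;
  kr_clopen : forall Z, cells P Z -> clopen Z;
  kr_partition :
    partition [set p : seq (set X) * nat | p.1 \in P /\ (p.2 < size p.1)%N]
      (fun p => nth set0 p.1 p.2) [set: X];
  kr_step : forall S j, S \in P -> (j.+1 < size S)%N ->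
    phi @` nth set0 S j = nth set0 S j.+1;
  kr_pt : top P x0;
  kr_top : phi @` top P = base P }.

Record KR := MkKR { towers :> {fset seq (set X)}; krP : is_KR towers }.

End KakutaniRokhlin.

(* [refines P Q] is P <= Q : the partition Q is finer than P. *)
Definition refines (X : topologicalType) (P Q : {fset seq (set X)}) : Prop :=
  forall Y, cells Q Y -> exists2 Z, cells P Z & Y `<=` Z.

Record sds_object (R : realType) := SDSObject {
  sys :> em_system R;
  krs : nat -> KR (@dyn _ sys) (@pt _ sys);
  krs0 : krs 0 = [fset [:: [set: sys]]]%fset :> {fset seq (set sys)};
  krs_refines : forall n, refines (krs n) (krs n.+1);
  krs_top : forall n, (0 < n)%N -> top (krs n.+1) `<=` top (krs n);
  krs_top_inter : \bigcap_(n in [set n | (0 < n)%N]) top (krs n) = [set @pt _ sys];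
  krs_basis : basis (\bigcup_n cells (krs n)) }.

Record sds_hom (R : realType) (X Y : sds_object R) := SDSHom {
  sds_map :> X -> Y;
  sds_cont : continuous sds_map;
  sds_equiv : forall x, sds_map (dyn x) = dyn (sds_map x);
  sds_pt : sds_map (@pt _ X) = @pt _ Y;
  (* Needed for the preimages of the (non-empty) cells of a Kakutani-Rokhlin
     partition of Y to form a Kakutani-Rokhlin partition of X. *)
  sds_surj : forall y, exists x, sds_map x = y }.

Section SDSCategory.
Variable R : realType.
Implicit Types X Y Z W : sds_object R.

Lemma sds_hom_eq X Y (f g : sds_hom X Y) : f =1 g -> f = g.
Proof.
case: f g => f a b c d [g a' b' c' d'] /= /funext E; subst g.
by congr SDSHom; apply: Prop_irrelevance.
Qed.

Lemma sds_id_surj X (y : X) : exists x : X, id x = y.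
Proof. by exists y. Qed.

Definition sds_id X : sds_hom X X :=
  @SDSHom R X X id (fun x => @cvg_id _ _) (fun=> erefl) erefl (@sds_id_surj X).

Lemma sds_comp_subproof X Y Z (g : sds_hom Y Z) (f : sds_hom X Y) :
  [/\ continuous (g \o f), forall x, (g \o f) (dyn x) = dyn ((g \o f) x),
      (g \o f) (@pt _ X) = @pt _ Z & forall z, exists x, (g \o f) x = z].
Proof.
split.
- move=> x; apply: continuous_comp; [exact: sds_cont|exact: sds_cont].
- by move=> x /=; rewrite !sds_equiv.
- by rewrite /= !sds_pt.
- move=> z; have [y <-] := sds_surj g z; have [x <-] := sds_surj f y.
  by exists x.
Qed.

Definition sds_comp X Y Z (g : sds_hom Y Z) (f : sds_hom X Y) : sds_hom X Z :=
  let: And4 a b c d := sds_comp_subproof g f in SDSHom a b c d.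

Lemma sds_compE X Y Z (g : sds_hom Y Z) (f : sds_hom X Y) :
  sds_comp g f =1 g \o f.
Proof. by rewrite /sds_comp; case: (sds_comp_subproof g f). Qed.

Lemma sds_comp1m X Y (f : sds_hom X Y) : sds_comp (sds_id Y) f = f.
Proof. by apply: sds_hom_eq => x; rewrite sds_compE. Qed.

Lemma sds_compm1 X Y (f : sds_hom X Y) : sds_comp f (sds_id X) = f.
Proof. by apply: sds_hom_eq => x; rewrite sds_compE. Qed.

Lemma sds_compmA X Y Z W (h : sds_hom Z W) (g : sds_hom Y Z) (f : sds_hom X Y) :
  sds_comp h (sds_comp g f) = sds_comp (sds_comp h g) f.
Proof. by apply: sds_hom_eq => x; rewrite !sds_compE /= !sds_compE. Qed.

Definition SDS : category :=
  @Category (sds_object R) (@sds_hom R) sds_id sds_comp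
    sds_comp1m sds_compm1 sds_compmA.

End SDSCategory.

(* [occurs S T k] : Y_{k+j} is contained in Z_j for 1 <= j <= n, where
   S = (Z_1,...,Z_n) and T = (Y_1,...,Y_m). *)
Definition occurs (X : Type) (S T : seq (set X)) (k : nat) : Prop :=
  (k + size S <= size T)%N /\
  forall j, (j < size S)%N -> nth set0 T (k + j) `<=` nth set0 S j.

(* The edges (S,T,k), where the source S is an index in a finite type I for the
   tower [tow S] of X: the case of E(P,Q) is [tow = val], and the case of the
   edges F_n of P(alpha) is [tow S = alpha^-1(S)]. *)
Section TowerEdges.
Variables (X : topologicalType) (phi : X -> X) (x0 : X).
Variables (I : finType) (tow : I -> seq (set X)) (Q : KR phi x0).
Hypothesis tow_height : forall S, (0 < size (tow S))%N.
Hypothesis tow_inj : forall S S' x,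
  head set0 (tow S) x -> head set0 (tow S') x -> S = S'.

Definition tow_edge :=
  {e : I * {T : Q & 'I_(size (val T))} |
    `[< occurs (tow e.1) (val (tag e.2)) (tagged e.2) >]}.

Definition tow_src (e : tow_edge) : I := (val e).1.
Definition tow_rng (e : tow_edge) : Q := tag (val e).2.
Definition tow_pos (e : tow_edge) : nat := tagged (val e).2.

Definition tow_le : rel tow_edge := fun e e' =>
  (tow_rng e == tow_rng e') && (tow_pos e <= tow_pos e')%N.

Lemma tow_le_refl : reflexive tow_le.
Proof. by move=> e; rewrite /tow_le eqxx leqnn. Qed.

Lemma tow_le_trans : transitive tow_le.
Proof.
move=> e2 e1 e3 /andP[/eqP a b] /andP[/eqP c d].
by rewrite /tow_le a c eqxx (leq_trans b d).
Qed.

Lemma tow_le_cmp e e' : (tow_le e e' || tow_le e' e) = (tow_rng e == tow_rng e').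
Proof.
rewrite /tow_le (eq_sym (tow_rng e')) -andb_orr.
by rewrite leq_total andbT.
Qed.

Lemma tow_le_anti : antisymmetric tow_le.
Proof.
move=> e e' /andP[/andP[/eqP + l] /andP[_ l']].
have {l l'} : tow_pos e = tow_pos e' by apply/eqP; rewrite eqn_leq l l'.
case: e e' => [[S [T k]] i] [[S' [T' k']] i']; rewrite /tow_pos /tow_rng /= => E E'.
subst T'; have Ek : k = k' by apply: val_inj.
subst k'; apply/val_inj => /=; congr pair.
move: (i) (i') => /asboolP[/= _ a] /asboolP[/= _ a'].
have [_ _ ne] := kr_partition (krP Q).
have [x xP] : nth set0 (fsval T) (k + 0) !=set0.
  by apply: (ne (fsval T, (k + 0)%N)); split; rewrite ?addn0 /=; [exact: fsvalP|exact: ltn_ord].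
by apply: (@tow_inj _ _ x); rewrite -nth0; [apply: a xP|apply: a' xP].
Qed.

Definition tow_edges : edge_set I Q :=
  @EdgeSet I Q tow_edge tow_src tow_rng tow_le
    tow_le_refl tow_le_anti tow_le_trans tow_le_cmp.

End TowerEdges.

Section KRTheory.
Variables (X : topologicalType) (phi : X -> X) (x0 : X).
Implicit Types P Q : KR phi x0.

Lemma kr_val_height P (S : P) : (0 < size (val S))%N.
Proof. exact: (kr_height (krP P) (fsvalP S)). Qed.

Lemma kr_disj P (S S' : P) j j' x : (j < size (val S))%N -> (j' < size (val S'))%N ->
  nth set0 (val S) j x -> nth set0 (val S') j' x -> S = S' /\ j = j'.
Proof.
have [_ tr _] := kr_partition (krP P) => h h' a b.
have : (val S, j) = (val S', j').
  by apply: tr; [split=> //; exact: fsvalP|split=> //; exact: fsvalP|exists x].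
by case=> /val_inj.
Qed.

Lemma kr_base_disj P (S S' : P) x :
  head set0 (val S) x -> head set0 (val S') x -> S = S'.
Proof.
by rewrite -!nth0 => a b; have [] := kr_disj (kr_val_height S) (kr_val_height S') a b.
Qed.

Lemma kr_occurs P Q (S : P) (T : Q) k x : refines P Q -> top Q `<=` top P ->
  (k < size (val T))%N -> nth set0 (val S) 0 x -> nth set0 (val T) k x ->
  occurs (val S) (val T) k.
Proof.
move=> ref tops kT xS xT.
have H j : (j < size (val S))%N ->
    (k + j < size (val T))%N /\ nth set0 (val T) (k + j) `<=` nth set0 (val S) j.
  elim: j => [|j IH] jS.
    rewrite addn0; split=> //.
    have [|Z [S' S'P /(nthP set0)[j' j'S' <-]] sub] := ref (nth set0 (val T) k).
      by exists (val T); [exact: fsvalP|exact: mem_nth].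
    have [E j0] := kr_disj (S' := [` S'P]%fset) jS j'S' xS (sub _ xT).
    by rewrite E j0.
  have [kj sub] := IH (ltnW jS).
  rewrite addnS; case: (ltnP (k + j).+1 (size (val T))) => [kj'|le].
    split=> //; rewrite -(kr_step (krP Q) (fsvalP T) kj').
    rewrite -(kr_step (krP P) (fsvalP S) jS).
    exact: image_subset.
  have E : (k + j)%N = (size (val T)).-1.
    by apply: succn_inj; rewrite (ltn_predK kj); apply/eqP; rewrite eqn_leq kj le.
  have [_ _ ne] := kr_partition (krP Q).
  have [y yP] : nth set0 (val T) (k + j) !=set0.
    by apply: (ne (val T, (k + j)%N)); split=> //=; exact: fsvalP.
  have [S' S'P] : top P y.
    by apply: tops; exists (val T); [exact: fsvalP|rewrite -nth_last -E].
  rewrite -nth_last => yS'.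
  have h' : ((size S').-1 < size (val [` S'P]%fset))%N.
    by rewrite /= prednK // (kr_height (krP P)).
  have [E1 E2] := kr_disj (S' := [` S'P]%fset) (ltnW jS) h' (sub _ yP) yS'.
  by move: jS; rewrite E1 E2 /= prednK ?ltnn // (kr_height (krP P)).
split; last by move=> j /H[].
case: (H (size (val S)).-1); first by rewrite prednK // kr_val_height.
by rewrite -ltnS -addnS prednK // ?kr_val_height.
Qed.

(* E(P,Q) *)
Definition kr_edges P Q : edge_set P Q :=
  @tow_edges _ _ _ P val Q (@kr_val_height P) (@kr_base_disj P).

Definition kr_edge P Q (S : P) (T : Q) k (kT : (k < size (val T))%N)
    (o : occurs (val S) (val T) k) : kr_edges P Q :=
  exist _ (S, Tagged (fun T : Q => 'I_(size (val T))) (Ordinal kT)) (asboolT o).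

Lemma kr_edges_src P Q (S : P) : refines P Q -> top Q `<=` top P ->
  exists e : kr_edges P Q, src e = S.
Proof.
move=> ref tops; have [_ _ ne] := kr_partition (krP P).
have [x xS] : nth set0 (val S) 0 !=set0.
  by apply: (ne (val S, 0)); split; [exact: fsvalP|exact: kr_val_height].
have [cov _ _] := kr_partition (krP Q).
have : [set: X] x by [].
rewrite -cov => -[[T k] [/= TQ kT] xT].
pose T' : Q := [` TQ]%fset; have kT' : (k < size (val T'))%N := kT.
by exists (kr_edge kT' (kr_occurs ref tops kT' xS xT)).
Qed.

Lemma kr_edges_rng P Q (T : Q) : refines P Q -> top Q `<=` top P ->
  exists e : kr_edges P Q, rng e = T.
Proof.
move=> ref tops; have [_ _ ne] := kr_partition (krP Q).
have T0 := kr_val_height T.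
have [x xT] : nth set0 (val T) 0 !=set0.
  by apply: (ne (val T, 0)); split; [exact: fsvalP|exact: T0].
have : base Q x by exists (val T); [exact: fsvalP|rewrite -nth0].
rewrite -(kr_top (krP Q)) => /(@image_subset _ _ phi _ _ tops).
rewrite (kr_top (krP P)) => -[S SP]; rewrite -nth0 => xS.
pose S' : P := [` SP]%fset.
by exists (kr_edge T0 (@kr_occurs _ _ S' T _ _ ref tops T0 xS xT)).
Qed.

Lemma kr_card_gt0 P : (0 < #|P|)%N.
Proof. by have [S SP _] := kr_pt (krP P); apply/card_gt0P; exists [` SP]%fset. Qed.

End KRTheory.

Section ObjectMap.
Variables (R : realType) (X : sds_object R).

Lemma krs_top_all n : top (krs X n.+1) `<=` top (krs X n).
Proof.
case: n => [|n]; last exact: krs_top.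
move=> x _; exists [:: [set: X]]; last by [].
by rewrite krs0 inE.
Qed.

Lemma krs_vtx0 : #|krs X 0| = 1.
Proof. by rewrite krs0 -cardfE cardfs1. Qed.

Lemma krs_edges_nonempty n : (0 < #|kr_edges (krs X n) (krs X n.+1)|)%N.
Proof.
have /card_gt0P[T _] := kr_card_gt0 (krs X n.+1).
have [e _] := kr_edges_rng T (@krs_refines _ X n) (@krs_top_all n).
by apply/card_gt0P; exists e.
Qed.

(* The label n in the pairs (n,T) is carried by the index of the family. *)
Definition P_ob : bratteli :=
  @Bratteli (fun n => krs X n : finType)
    (fun n => kr_edges (krs X n) (krs X n.+1))
    (fun n => kr_card_gt0 (krs X n)) krs_vtx0 krs_edges_nonempty
    (fun n S => kr_edges_src S (@krs_refines _ X n) (@krs_top_all n))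
    (fun n T => kr_edges_rng T (@krs_refines _ X n) (@krs_top_all n)).

End ObjectMap.

Section MorphismMap.
Variables (R : realType) (X Y : sds_object R) (alpha : sds_hom X Y).

Definition pre_tower (S : seq (set Y)) : seq (set X) :=
  [seq alpha @^-1` Z | Z <- S].

Definition pre_partition (Q : {fset seq (set Y)}) : {fset seq (set X)} :=
  [fset pre_tower S | S in Q]%fset.

Definition admissible (f : nat -> nat) : Prop :=
  [/\ f 0 = 0, forall n, (f n <= f n.+1)%N, forall N, exists n, (N <= f n)%N,
      forall n, refines (pre_partition (krs Y n)) (krs X (f n)) &
      forall n, top (krs X (f n)) `<=` top (pre_partition (krs Y n))].

Lemma pre_tower_height n (S : krs Y n) : (0 < size (pre_tower (val S)))%N.
Proof. by rewrite size_map kr_val_height. Qed.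

Lemma pre_tower_inj n (S S' : krs Y n) x :
  head set0 (pre_tower (val S)) x -> head set0 (pre_tower (val S')) x -> S = S'.
Proof.
rewrite -!nth0 !(nth_map set0) ?kr_val_height //= !nth0.
exact: kr_base_disj.
Qed.

(* The edge set F_n from the towers of Q_n to the towers of P_{f_n}. *)
Definition P_edges (f : nat -> nat) n :
    edge_set (vtx (P_ob Y) n) (vtx (P_ob X) (f n)) :=
  @tow_edges _ _ _ (krs Y n) (fun S => pre_tower (val S)) (krs X (f n))
    (@pre_tower_height n) (@pre_tower_inj n).

(* [c] is the class of the premorphism (F, (f_n)) for every choice of (f_n),
   and some choice exists. *)
Definition P_value (c : obd_hom (P_ob Y) (P_ob X)) : Prop :=
  (exists f, admissible f) /\
  forall f, admissible f ->
    exists pf : is_premorphism (P_edges f), c = obd_class (Premorphism pf).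

End MorphismMap.

(* Main.v *)
From mathcomp Require Import all_boot finmap.
From mathcomp Require Import boolp classical_sets reals topology.
Require Import Defs.

Set Implicit Arguments.
Unset Strict Implicit.
Unset Printing Implicit Defensive.

(** An ordered edge set from S to T is determined up to isomorphism by its
words: the word of t in T lists the sources of the edges with range t in
increasing order.  Composition of edge sets is then composition of
substitutions, the word of u in F o G being the concatenation of the F-words of
the letters of the G-word of u ([eiso_eword], [eword_eiso], [eword_comp]).

In E(P,Q) the word of a tower T of Q is the list of the towers of P that T
passes through, and it is the only list of towers of P whose concatenation has
the height of T and contains T level by level ([eword_tow_edges]).  The same
holds for the edges of P(alpha), with the towers of alpha^-1(Q_n) in place of
those of P.  Every isomorphism of edge sets needed to make P a functor follows:
both sides have words that cut the same tower into towers of the same family,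
and such a cutting is unique ([cuts_uniq]).  Compactness supplies the indices
f_n at which the P_{f_n} are fine enough.

Faithfulness: if P(alpha) = P(beta), the zigzag of an equivalence gives, for
every n and a large m, one word that cuts the towers of P_m both into towers of
alpha^-1(Q_n) and into towers of beta^-1(Q_n).  So alpha x and beta x lie in
the same cell of every Q_n, and these cells separate points.

Fullness: let (F_n) be a premorphism from P(Y) to P(X), with indices f_n, and T
a tower of P_{f_n}.  The towers of Q_n listed by the F_n-word of T concatenate
to a sequence of cells of Y.  Its length is the height of T, as comparison with
level 0 shows: there each path counts one level ([size_code]).  A point x in
level j of T is assigned the j-th of these cells; the relation between F_n and
F_{n+1} makes the cells decrease with n ([code_succ]), and their intersection
is a single point alpha x, by compactness.  The word of T in P(alpha) is the
F_n-word of T by construction, and surjectivity of alpha comes from each tower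
of Q_n being the source of an edge of F_n.  That alpha intertwines the two
homeomorphisms is immediate if the n-th cell of x is below the top of its tower
for arbitrarily large n; otherwise both points to be compared lie in the base of
Q_n for all large n, and these bases shrink to the image of y_0 ([decoded_step], [decoded_equiv]). *)

Local Open Scope classical_set_scope.

(** * Ordered edge sets as substitutions *)

Section Words.
Variables S T : finType.
Implicit Types (F G : edge_set S T) (t : T).

Definition estrict F : rel F := fun e e' => (e != e') && ele e e'.

Definition efiber F t : seq F := sort (@ele _ _ F) (enum [pred e : F | rng e == t]).

Definition eword F t : seq S := [seq src e | e <- efiber F t].

Lemma mem_efiber F t e : (e \in efiber F t) = (rng e == t).
Proof. by rewrite mem_sort mem_enum. Qed.

Lemma efiber_uniq F t : uniq (efiber F t).
Proof. by rewrite sort_uniq enum_uniq. Qed.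

Lemma estrict_trans F : transitive (@estrict F).
Proof.
move=> y x z /andP[xy lxy] /andP[yz lyz]; rewrite /estrict (ele_trans lxy lyz) andbT.
apply: contraNneq xy => xz; apply/eqP/(@ele_anti _ _ F).
by rewrite lxy xz.
Qed.

(** The order is total on a fibre only, hence the relative form of the sorting
lemma. *)
Lemma efiber_sorted F t : sorted (@ele _ _ F) (efiber F t).
Proof.
apply: (sort_sorted_in (P := [pred e : F | rng e == t])) => [e e'|].
  by rewrite !inE => /eqP h /eqP h'; rewrite ele_cmp h h' eqxx.
by apply/allP => e; rewrite mem_enum.
Qed.

Lemma efiber_strict F t : pairwise (@estrict F) (efiber F t).
Proof.
have := efiber_sorted F t; rewrite (sorted_pairwise (@ele_trans _ _ F)).
have := efiber_uniq F t; rewrite uniq_pairwise => u s.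
have := conj u s => /andP; rewrite -pairwise_relI.
by apply: sub_pairwise.
Qed.

(** A finite set carries at most one strictly increasing enumeration; this is
how every word below gets computed. *)
Lemma efiber_eq F t (s : seq F) : pairwise (@estrict F) s ->
  (forall e, (e \in s) = (rng e == t)) -> efiber F t = s.
Proof.
rewrite -(sorted_pairwise (@estrict_trans F)) => ss ms.
apply: (irr_sorted_eq (@estrict_trans F)) => //.
- by move=> e; rewrite /estrict eqxx.
- by rewrite (sorted_pairwise (@estrict_trans F)) efiber_strict.
- by move=> e; rewrite mem_efiber ms.
Qed.

Lemma mem_eword F (e : F) : src e \in eword F (rng e).
Proof. by apply: map_f; rewrite mem_efiber. Qed.

(** The order can be recovered from ranks in the fibres, which is why words lose
no information. *)
Lemma ele_index F (e e' : F) : ele e e' = (rng e == rng e') &&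
  (index e (efiber F (rng e)) <= index e' (efiber F (rng e')))%N.
Proof.
have [E|ne] /= := eqVneq (rng e) (rng e'); last first.
  by apply: contraNF ne; rewrite -ele_cmp => ->.
rewrite E; set s := efiber F (rng e').
have es : e \in s by rewrite mem_efiber E.
have es' : e' \in s by rewrite mem_efiber.
have H a b : a \in s -> b \in s -> (index a s < index b s)%N -> estrict a b.
  move=> sa sb lt; have /(pairwiseP a) := efiber_strict F (rng e').
  move=> /(_ (index a s) (index b s)); rewrite !inE !index_mem !nth_index //.
  exact.
case: (ltngtP (index e s) (index e' s)) => [/H|/H|/index_inj].
- by move=> /(_ es es') /andP[].
- move=> /(_ es' es) /andP[ne le]; apply: contraNF ne => le'.
  by apply/eqP/(@ele_anti _ _ F); rewrite le le'.
- by move=> /(_ e es es') ->; rewrite ele_refl.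
Qed.

Lemma eiso_eword F G : eiso F G -> forall t, eword F t = eword G t.
Proof.
case=> h [bh hs hr hl] t; have [k hk kh] := bh.
rewrite /eword (@efiber_eq G t (map h (efiber F t))).
- by rewrite -map_comp; apply: eq_map => e /=; rewrite hs.
- rewrite pairwise_map; apply: sub_pairwise (efiber_strict F t) => e e'.
  by rewrite /estrict /= hl (inj_eq (can_inj hk)).
- move=> e; rewrite -(kh e) (mem_map (can_inj hk)) mem_efiber.
  by rewrite -(hr (k e)).
Qed.

Lemma eword_match F G : (forall t, eword F t = eword G t) ->
  forall e : F, exists g : G, [/\ src g = src e, rng g = rng e &
    index g (efiber G (rng g)) = index e (efiber F (rng e))].
Proof.
move=> E e; have sz : size (efiber F (rng e)) = size (efiber G (rng e)).
  by rewrite -(size_map (@src _ _ F)) -/(eword _ _) E size_map.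
have := mem_efiber (rng e) e; rewrite eqxx -index_mem sz.
case fG : (efiber G (rng e)) => [//|g0 s]; rewrite -fG => lt.
have gr : rng (nth g0 (efiber G (rng e)) (index e (efiber F (rng e)))) = rng e.
  by apply/eqP; rewrite -mem_efiber mem_nth.
exists (nth g0 (efiber G (rng e)) (index e (efiber F (rng e)))); split=> //.
- have := congr1 (fun s => nth (src e) s (index e (efiber F (rng e)))) (E (rng e)).
  by rewrite /eword (nth_map e) ?sz // (nth_map g0) // nth_index ?mem_efiber.
- by rewrite gr index_uniq ?efiber_uniq.
Qed.

(** The isomorphism sends an edge to the edge with the same range and the same
rank in its fibre. *)
Lemma eword_eiso F G : (forall t, eword F t = eword G t) -> eiso F G.
Proof.
move=> E; have [h hP] := choice (eword_match E).
have [k kP] := choice (eword_match (fun t => esym (E t))).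
have inj (H : edge_set S T) (e e' : H) : rng e = rng e' ->
    index e (efiber H (rng e)) = index e' (efiber H (rng e')) -> e = e'.
  by move=> r; rewrite -r => /(index_inj e) -> //; rewrite mem_efiber ?r.
exists h; split.
- exists k => [e|g].
    case: (hP e) => _ r i; case: (kP (h e)) => _ r' i'.
    by apply: inj; rewrite ?i' // r'.
  case: (kP g) => _ r i; case: (hP (k g)) => _ r' i'.
  by apply: inj; rewrite ?i' // r'.
- by move=> e; case: (hP e).
- by move=> e; case: (hP e).
- move=> e e'; rewrite !ele_index.
  by case: (hP e) => _ -> ->; case: (hP e') => _ -> ->.
Qed.

End Words.

(** The order of F o G compares the second components first, so that the fibre
over u runs through the edges of G into u and, for each, through a fibre of F. *)
Lemma eword_comp (S T U : finType) (F : edge_set S T) (G : edge_set T U) u :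
  eword (F \oe G) u = flatten [seq eword F t | t <- eword G u].
Proof.
pose L (gs : seq G) : seq (F * G) :=
  flatten [seq [seq (e, g) | e <- efiber F (src g)] | g <- gs].
have L_in (gs : seq G) p : (p \in L gs) = (p.2 \in gs) && (rng p.1 == src p.2).
  apply/flatten_mapP/andP => [[g gi /mapP[e]]|[pi pr]].
    by rewrite mem_efiber => er -> /=.
  by exists p.2 => //; apply/mapP; exists p.1; rewrite ?mem_efiber //; case: (p).
pose lt (p q : F * G) := (p != q) && (((p.2 != q.2) && ele p.2 q.2)
  || ((p.2 == q.2) && ele p.1 q.1)).
have L_lt (gs : seq G) : pairwise (@estrict _ _ G) gs -> pairwise lt (L gs).
  elim: gs => //= g gs IH /andP[gall gpw]; rewrite pairwise_cat IH // andbT.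
  apply/andP; split; last first.
    rewrite pairwise_map; apply: sub_pairwise (efiber_strict F (src g)) => e e'.
    by rewrite /estrict /lt /= xpair_eqE eqxx /= andbT => /andP[-> ->].
  apply/allrelP => p q /mapP[e _ ->]; rewrite L_in => /andP[qg _].
  have /andP[ne le] := allP gall _ qg.
  by rewrite /lt /= ne le /= andbT; apply: contraNneq ne => <-.
pose s : seq (F \oe G) := pmap insub (L (efiber G u)).
have sE : map val s = L (efiber G u).
  rewrite (pmap_filter (@insubK _ _ _)); apply/all_filterP/allP => p.
  by rewrite L_in => /andP[_ pr]; rewrite /= insubT.
rewrite /eword (@efiber_eq _ _ (F \oe G) u s).
- rewrite -[LHS]/(map ((fun p => src p.1) \o val) s) map_comp sE /L.
  elim: (efiber G u) => //= g gs IH; rewrite map_cat IH -map_comp /=; congr cat.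
- have := L_lt _ (efiber_strict G u); rewrite -sE pairwise_map.
  exact: sub_pairwise.
- move=> p; rewrite -(mem_map val_inj) sE L_in (valP p) andbT mem_efiber //.
Qed.

Lemma eword_diag (V : nat -> finType) k v : eword (diag_edges V k k) v = [:: v].
Proof.
pose d : diag_edges V k k := dpair (eqxx (Tagged V v)).
rewrite /eword (@efiber_eq _ _ _ v [:: d]) // => -[[a b] i].
rewrite inE -val_eqE /= xpair_eqE andbC.
by move: i; rewrite /= eq_Tagged /= => /eqP ->; rewrite andbb.
Qed.

(** * Cutting towers into towers *)

Lemma size_flatten_map (J A B : Type) (u : J -> seq A) (v : J -> seq B) s :
  (forall i, size (u i) = size (v i)) ->
  size (flatten (map u s)) = size (flatten (map v s)).
Proof. by move=> H; elim: s => //= i s IH; rewrite !size_cat H IH. Qed.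

(** Two families of blocks are treated together in order to compare sequences of
cells of X with sequences of cells of Y; g = f gives the block of an entry. *)
Lemma nth_flatten_parallel (I : Type) (A B : Type) (a : A) (b : B)
    (f : I -> seq A) (g : I -> seq B) (v : seq I) k :
  (forall i, size (f i) = size (g i)) -> (k < size (flatten (map f v)))%N ->
  exists i j, [/\ (j < size (f i))%N, nth a (flatten (map f v)) k = nth a (f i) j &
    nth b (flatten (map g v)) k = nth b (g i) j].
Proof.
move=> sz; elim: v k => //= i v IH k; rewrite size_cat !nth_cat sz.
have [lt _|le lt] := ltnP k (size (g i)); first by exists i, k; rewrite sz.
by apply: IH; rewrite ltn_subLR.
Qed.

Section Coarsening.
Variable X : Type.
Implicit Types t u : seq (set X).

(** Beyond the common length both entries are the default [set0], for which the
inclusion is trivial. *)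
Definition coarsens t u : Prop :=
  size u = size t /\ forall j, nth set0 t j `<=` nth set0 u j.

Lemma nth_set0_lt t j x : nth set0 t j x -> (j < size t)%N.
Proof. by case: (ltnP j (size t)) => [//|le]; rewrite nth_default //. Qed.

Lemma coarsens_refl t : coarsens t t.
Proof. by split=> // j. Qed.

Lemma coarsens_trans u t v : coarsens t u -> coarsens u v -> coarsens t v.
Proof.
move=> [s1 h1] [s2 h2]; split; first by rewrite s2.
by move=> j x /h1/h2.
Qed.

Lemma coarsens_cat t t' u u' :
  coarsens t u -> coarsens t' u' -> coarsens (t ++ t') (u ++ u').
Proof.
move=> [s1 h1] [s2 h2]; split; first by rewrite !size_cat s1 s2.
by move=> j; rewrite !nth_cat s1; case: ltnP.
Qed.

Lemma coarsens_flatten (J : Type) (f g : J -> seq (set X)) (v : seq J) :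
  (forall i, coarsens (f i) (g i)) ->
  coarsens (flatten (map f v)) (flatten (map g v)).
Proof.
by move=> H; elim: v => [|i v IH] /=; [exact: coarsens_refl|exact: coarsens_cat].
Qed.

Definition cuts (I : Type) (tow : I -> seq (set X)) (w : seq I) t : Prop :=
  coarsens t (flatten (map tow w)).

Lemma cuts_flatten (I J : Type) (tow : I -> seq (set X)) (tow' : J -> seq (set X))
    (u : J -> seq I) (v : seq J) t :
  cuts tow' v t -> (forall i, cuts tow (u i) (tow' i)) ->
  cuts tow (flatten (map u v)) t.
Proof.
move=> tv H; apply: coarsens_trans tv _.
rewrite map_flatten -map_comp.
have -> : flatten (flatten (map (map tow \o u) v)) =
    flatten (map (fun i => flatten (map tow (u i))) v).
  by elim: v => //= i v IH; rewrite flatten_cat IH.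
exact: coarsens_flatten.
Qed.

End Coarsening.

Lemma coarsens_preimage (X Y : Type) (alpha : X -> Y) (t u : seq (set Y)) :
  coarsens t u -> coarsens (map (preimage alpha) t) (map (preimage alpha) u).
Proof.
move=> [s h]; split; first by rewrite !size_map.
move=> j x tx; have := nth_set0_lt tx; move: tx.
rewrite size_map => + lt; rewrite !(nth_map set0) ?s //; exact: h.
Qed.

Section TowerFamilies.
Variables (X : Type) (phi : X -> X).

(** What the arguments use of a Kakutani-Rokhlin partition, stated pointwise for
a family of towers indexed by any type: it applies to the partitions themselves
and to their preimages, which stay indexed by the towers downstairs. *)
Record tower_family (I : Type) (tow : I -> seq (set X)) : Prop := TowerFamily {
  tf_cover : forall x, exists S j, nth set0 (tow S) j x;
  tf_disj : forall S S' j j' x,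
    nth set0 (tow S) j x -> nth set0 (tow S') j' x -> S = S' /\ j = j';
  tf_height : forall S, (0 < size (tow S))%N;
  tf_nonempty : forall S j, (j < size (tow S))%N -> nth set0 (tow S) j !=set0;
  tf_step : forall S j x, (j.+1 < size (tow S))%N -> nth set0 (tow S) j x ->
    nth set0 (tow S) j.+1 (phi x);
  tf_return : forall S x, last set0 (tow S) x -> exists S', head set0 (tow S') (phi x);
  tf_return_inv : forall S x, head set0 (tow S) x ->
    exists S' y, last set0 (tow S') y /\ x = phi y }.

Section Family.
Variables (I : Type) (tow : I -> seq (set X)).
Hypothesis towP : tower_family tow.

Lemma last_height S x j : nth set0 (tow S) j x ->
  last set0 (tow S) x <-> j.+1 = size (tow S).
Proof.
move=> Sx; rewrite -nth_last; split=> [lx|<- //].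
have [_ ->] := tf_disj towP Sx lx.
by rewrite prednK // (tf_height towP).
Qed.

(** The first level of t lies in the first level of only one tower; remove that
tower and repeat. *)
Lemma cuts_uniq (t : seq (set X)) w w' :
  (forall j, (j < size t)%N -> nth set0 t j !=set0) ->
  cuts tow w t -> cuts tow w' t -> w = w'.
Proof.
elim: w t w' => [|S w IH] t [|S' w'] ne [/= s h] [/= s' h'] //.
- by move: s'; rewrite -s size_cat => /eqP; rewrite addn_eq0 eqn0Ngt (tf_height towP).
- by move: s; rewrite -s' size_cat => /eqP; rewrite addn_eq0 eqn0Ngt (tf_height towP).
have [x tx] : nth set0 t 0 !=set0.
  by apply: ne; rewrite -s size_cat addn_gt0 (tf_height towP).
have := h 0 x tx; have := h' 0 x tx; rewrite !nth_cat !(tf_height towP) => a b.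
have [E _] := tf_disj towP b a; subst S'; congr cons.
apply: (IH (drop (size (tow S)) t)).
- by move=> j; rewrite size_drop nth_drop ltn_subRL; apply: ne.
- split; first by rewrite size_drop -s size_cat addKn.
  by move=> j; rewrite nth_drop => y /h; rewrite nth_cat ltnNge leq_addr addKn.
- split; first by rewrite size_drop -s' size_cat addKn.
  by move=> j; rewrite nth_drop => y /h'; rewrite nth_cat ltnNge leq_addr addKn.
Qed.

End Family.

Section Finer.
Variables (I J : Type) (tow : I -> seq (set X)) (tow' : J -> seq (set X)).
Hypotheses (towP : tower_family tow) (towP' : tower_family tow').

Definition finer : Prop :=
  (forall T j, (j < size (tow' T))%N ->
     exists S i, nth set0 (tow' T) j `<=` nth set0 (tow S) i) /\
  (forall T x, last set0 (tow' T) x -> exists S, last set0 (tow S) x).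

Hypothesis fine : finer.

(** By disjointness, meeting a cell of the coarser family is enough to be
contained in it. *)
Lemma finer_cell T j x S i : nth set0 (tow' T) j x -> nth set0 (tow S) i x ->
  nth set0 (tow' T) j `<=` nth set0 (tow S) i.
Proof.
move=> Tx Sx; have [S' [i' sub]] := fine.1 _ _ (nth_set0_lt Tx).
by have [-> ->] := tf_disj towP Sx (sub _ Tx).
Qed.

(** Follow the orbit of x up the tower S.  It cannot leave T before leaving S,
because the top of T lies in the top of the coarser family. *)
Lemma finer_occurs T k x S : nth set0 (tow' T) k x -> head set0 (tow S) x ->
  (k + size (tow S) <= size (tow' T))%N /\
  forall j, (j < size (tow S))%N ->
    nth set0 (tow' T) (k + j) `<=` nth set0 (tow S) j.
Proof.
rewrite -nth0 => Tx Sx.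
have H j : (j < size (tow S))%N -> exists y,
    nth set0 (tow' T) (k + j) y /\ nth set0 (tow S) j y.
  elim: j => [|j IH] jS; first by exists x; rewrite addn0.
  have [y [Ty Sy]] := IH (ltnW jS).
  exists (phi y); split; last exact: (tf_step towP).
  rewrite addnS; apply: (tf_step towP') => //.
  rewrite ltn_neqAle (nth_set0_lt Ty) andbT; apply/negP => /eqP.
  move=> top; have [S' lS'] := fine.2 _ _ ((last_height towP' Ty).2 top).
  have lS2 : nth set0 (tow S') (size (tow S')).-1 y by rewrite nth_last.
  have [E _] := tf_disj towP Sy lS2; subst S'.
  by move: jS; rewrite ((last_height towP Sy).1 lS') ltnn.
split.
  have lt : ((size (tow S)).-1 < size (tow S))%N by rewrite prednK ?(tf_height towP).
  have [y [Ty _]] := H _ lt; move: (nth_set0_lt Ty).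
  by rewrite -addnS prednK // (tf_height towP).
by move=> j jS; have [y [Ty Sy]] := H _ jS; apply: finer_cell Ty Sy.
Qed.

Lemma finer_base T x : head set0 (tow' T) x -> exists S, head set0 (tow S) x.
Proof.
move=> /(tf_return_inv towP')[T' [y [/fine.2[S lS] ->]]].
exact (tf_return towP lS).
Qed.

(** T starts in the base of the coarser family, since its base is the image of a
top; each time a tower of that family has been climbed, the orbit is back in the
base, or T is exhausted. *)
Lemma cuts_exists T : exists w, cuts tow w (tow' T).
Proof.
suff H n k x S : (size (tow' T) - k <= n)%N -> nth set0 (tow' T) k x ->
    head set0 (tow S) x -> exists w, cuts tow w (drop k (tow' T)).
  have [x Tx] := tf_nonempty towP' (S := T) (tf_height towP' T).
  have [S Sx] : exists S, head set0 (tow S) x by apply: (@finer_base T); rewrite -nth0.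
  by rewrite -(drop0 (tow' T)); exact: H _ 0 x S (leqnn _) Tx Sx.
elim: n k x S => [|n IH] k x S.
  rewrite leqn0 subn_eq0 => le Tx.
  by have := nth_set0_lt Tx; rewrite ltnNge le.
move=> le Tx Sx; have [kS sub] := finer_occurs Tx Sx.
have S0 := tf_height towP S; set h := size (tow S) in kS sub S0.
(* The h levels of T from k on follow S; the induction hypothesis cuts the rest. *)
have c1 : coarsens (take h (drop k (tow' T))) (tow S).
  split; first by rewrite size_takel // size_drop leq_subRL // (leq_trans (leq_addr _ _) kS).
  move=> j y; have [jh|hj] := ltnP j h; first by rewrite nth_take // nth_drop; apply: sub.
  by rewrite nth_default // (leq_trans _ hj) // size_take_min geq_minl.
have dE : drop k (tow' T) = take h (drop k (tow' T)) ++ drop (k + h) (tow' T).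
  by rewrite addnC -drop_drop cat_take_drop.
have [E|ne] := eqVneq (k + h)%N (size (tow' T)).
  exists [:: S]; rewrite /cuts /= cats0 dE E drop_size cats0; exact: c1.
have lt : (k + h < size (tow' T))%N by rewrite ltn_neqAle ne.
have eh : (k + h.-1).+1 = (k + h)%N by rewrite -addnS prednK.
have [y Ty] : nth set0 (tow' T) (k + h.-1) !=set0.
  by apply: (tf_nonempty towP'); rewrite eh ltnW.
have Sy : last set0 (tow S) y.
  by rewrite -nth_last; apply: sub Ty; rewrite prednK.
have [S' S'y] := tf_return towP Sy.
have T'y : nth set0 (tow' T) (k + h) (phi y).
  by rewrite -eh; apply: (tf_step towP') => //; rewrite eh.
have [|w wP] := IH _ _ _ _ T'y S'y.
  by rewrite subnDA leq_subLR (leq_trans le) // -add1n leq_add2r.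
by exists (S :: w); rewrite /cuts dE; apply: coarsens_cat.
Qed.

End Finer.
End TowerFamilies.

Section Offsets.
Variables (X I : Type) (tow : I -> seq (set X)) (d : I).
Hypothesis tow_height : forall S, (0 < size (tow S))%N.

Definition offset (w : seq I) i := size (flatten (map tow (take i w))).

Lemma offset_le w i : (i < size w)%N ->
  (offset w i + size (tow (nth d w i)) <= size (flatten (map tow w)))%N.
Proof.
move=> iw; rewrite -{3}(cat_take_drop i w) (drop_nth d iw) map_cat flatten_cat /=.
by rewrite !size_cat leq_add2l leq_addr.
Qed.

Lemma offset_lt w i j : (i < j < size w)%N -> (offset w i < offset w j)%N.
Proof.
elim: w i j => [|S w IH] [|i] [|j]; rewrite ?ltn0 ?andbF //=.
  by rewrite /offset /= size_cat addn_gt0 tow_height.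
by rewrite !ltnS => /IH; rewrite /offset /= !size_cat ltn_add2l.
Qed.

Lemma nth_flatten_offset w i j : (i < size w)%N -> (j < size (tow (nth d w i)))%N ->
  nth set0 (flatten (map tow w)) (offset w i + j) = nth set0 (tow (nth d w i)) j.
Proof.
move=> iw jS; rewrite -{1}(cat_take_drop i w) (drop_nth d iw) map_cat flatten_cat /=.
by rewrite nth_cat ltnNge leq_addr /= addKn nth_cat jS.
Qed.

Lemma offset_ex w k : (k < size (flatten (map tow w)))%N ->
  exists i j, [/\ (i < size w)%N, (j < size (tow (nth d w i)))%N & k = (offset w i + j)%N].
Proof.
elim: w k => //= S w IH k; rewrite size_cat.
have [kS _|Sk kl] := ltnP k (size (tow S)); first by exists 0, k.
have [|i [j [iw jS E]]] := IH (k - size (tow S))%N; first by rewrite ltn_subLR.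
exists i.+1, j; split=> //.
by rewrite /offset /= size_cat -addnA -/(offset w i) -E subnKC.
Qed.

Lemma nth_flatten_mem w n i : (n < size w)%N -> (i < size (tow (nth d w n)))%N ->
  exists k, (k < size (flatten (map tow w)))%N /\
    nth set0 (flatten (map tow w)) k = nth set0 (tow (nth d w n)) i.
Proof.
move=> nw iS; exists (offset w n + i)%N.
rewrite (nth_flatten_offset nw iS); split=> //.
by apply: leq_trans (offset_le nw); rewrite ltn_add2l.
Qed.

(** Used to follow a concatenation of towers along one step of the homeomorphism:
past the top of a tower, the next cell may be the bottom of any tower. *)
Lemma nth_flatten_next w k : (k < size (flatten (map tow w)))%N ->
  exists S i, [/\ (i < size (tow S))%N, nth set0 (flatten (map tow w)) k = nth set0 (tow S) i &
    [/\ (i.+1 < size (tow S))%N, (k.+1 < size (flatten (map tow w)))%N &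
        nth set0 (flatten (map tow w)) k.+1 = nth set0 (tow S) i.+1] \/
    i.+1 = size (tow S) /\ (k.+1 = size (flatten (map tow w)) \/
      exists S', nth set0 (flatten (map tow w)) k.+1 = nth set0 (tow S') 0)].
Proof.
elim: w k => //= S w IH k; rewrite size_cat !nth_cat.
have [kS _|Sk kl] := ltnP k (size (tow S)).
  exists S, k; split=> //; have [lt|le] := ltnP k.+1 (size (tow S)).
    by left; rewrite ltn_addr.
  have E : k.+1 = size (tow S) by apply/eqP; rewrite eqn_leq kS le.
  right; split=> //; rewrite E subnn.
  case: w {IH} => [|S' w]; first by left; rewrite addn0.
  by right; exists S'; rewrite /= nth_cat tow_height.
have [|S' [i [iS E N]]] := IH (k - size (tow S))%N; first by rewrite ltn_subLR.
have -> : (k.+1 < size (tow S))%N = false by rewrite ltnNge (leqW Sk).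
exists S', i; split=> //; rewrite subSn //.
case: N => [[a b c]|[a [b|b]]]; [left|right|right]; split=> //.
- by rewrite -ltn_subLR ?subSn // leqW.
- by left; rewrite -b -subSn // subnKC // leqW.
- by right.
Qed.

End Offsets.

(** * Words of tower edge sets *)

Section TowerWords.
Variables (X : topologicalType) (phi : X -> X) (x0 : X).

Lemma KR_family (P : KR phi x0) : tower_family phi (fun S : P => val S).
Proof.
have [cov tr ne] := kr_partition (krP P).
have lastP (S : P) x : last set0 (val S) x -> top P x.
  by move=> lx; exists (val S) => //; exact: fsvalP.
split.
- move=> x; have : [set: X] x by [].
  by rewrite -cov => -[[S j] [/= SP jS] xS]; exists [` SP]%fset, j.
- move=> S S' j j' x Sx Sx'.
  exact: kr_disj (nth_set0_lt Sx) (nth_set0_lt Sx') Sx Sx'.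
- exact: kr_val_height.
- by move=> S j jS; apply: (ne (val S, j)); split=> //; exact: fsvalP.
- move=> S j x jS Sx; rewrite -(kr_step (krP P) (fsvalP S) jS).
  by exists x.
- move=> S x /lastP Px.
  have : base P (phi x) by rewrite -(kr_top (krP P)); exists x.
  by case=> S' S'P h; exists [` S'P]%fset.
- move=> S x Sx.
  have : base P x by exists (val S) => //; exact: fsvalP.
  rewrite -(kr_top (krP P)) => -[y [S' S'P ly] <-].
  by exists [` S'P]%fset, y.
Qed.

Variables (I : finType) (tow : I -> seq (set X)) (Q : KR phi x0).
Hypothesis tow_height : forall S, (0 < size (tow S))%N.
Hypothesis tow_inj : forall S S' x,
  head set0 (tow S) x -> head set0 (tow S') x -> S = S'.
Hypothesis towP : tower_family phi tow.

(** The i-th tower of w occurs in T at its offset.  There are no other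
occurrences: a tower that occurs at height k meets, with its first level, the
cell of the concatenation at height k, which must then be the first level of a
tower of w, so that k is an offset. *)
Lemma eword_tow_edges (T : Q) (w : seq I) : cuts tow w (val T) ->
  eword (tow_edges Q tow_height tow_inj) T = w.
Proof.
move=> [sz sub]; set E := tow_edges _ _ _.
have d : I.
  by case: w sz {sub} => [/= /esym/eqP|//]; rewrite eqn0Ngt kr_val_height.
have pos_occurs i : (i < size w)%N -> occurs (tow (nth d w i)) (val T) (offset tow w i).
  move=> iw; split; first by rewrite -sz offset_le.
  move=> j jS x /sub; rewrite (nth_flatten_offset iw jS) //.
have ex (i : 'I_(size w)) : exists e : E,
    [/\ src e = nth d w i, rng e = T & tow_pos e = offset tow w i].
  have o := pos_occurs i (ltn_ord i).
  have lt : (offset tow w i < size (val T))%N.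
    by apply: leq_trans o.1; rewrite -addn1 leq_add2l.
  by exists (exist _ (nth d w i, Tagged (fun T : Q => 'I_(size (val T))) (Ordinal lt)) (asboolT o)).
have [h hP] := choice ex.
rewrite /eword (@efiber_eq _ _ E T [seq h i | i <- enum 'I_(size w)]).
- rewrite -map_comp -[RHS](mkseq_nth d) /mkseq -val_enum_ord -map_comp.
  by apply: eq_map => i /=; case: (hP i).
- rewrite pairwise_map; have := iota_ltn_sorted 0 (size w).
  rewrite (sorted_pairwise ltn_trans) -val_enum_ord pairwise_map.
  apply: sub_pairwise => i j /= ij; rewrite /estrict.
  have lt : (tow_pos (h i) < tow_pos (h j))%N.
    have [_ _ ->] := hP i; have [_ _ ->] := hP j.
    by apply: (offset_lt tow_height); rewrite ij /=.
  apply/andP; split; first by apply: contraTneq lt => ->; rewrite ltnn.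
  rewrite /= /tow_le (ltnW lt) andbT.
  by have [_ /= -> _] := hP i; have [_ /= -> _] := hP j.
- move=> e; apply/mapP/eqP => [[i _ ->]|eT]; first by case: (hP i).
  have /asboolP[/= le occ] := valP e; move: eT le occ => /= eT.
  rewrite -/(tow_rng e) -/(tow_pos e) -/(tow_src e) eT => le occ.
  have lt : (tow_pos e < size (val T))%N.
    by apply: leq_trans le; rewrite -addn1 leq_add2l.
  have [x Tx] := tf_nonempty (KR_family Q) lt.
  have := nth_set0_lt (sub _ _ Tx) => /(offset_ex d)[i [j [iw jS kE]]].
  have Sx := sub _ _ Tx; rewrite kE (nth_flatten_offset iw jS) in Sx.
  have := occ 0 (tow_height _); rewrite addn0 => /(_ _ Tx) Sx'.
  have [Es Ej] := tf_disj towP Sx Sx'; rewrite Ej addn0 in kE.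
  exists (Ordinal iw); first by rewrite mem_enum.
  apply/(@ele_anti _ _ E)/andP; rewrite /= /tow_le.
  by have [_ /= -> ->] := hP (Ordinal iw); rewrite eT eqxx kE leqnn.
Qed.

(** Some cutting exists by [cuts_exists], and the word is the only one. *)
Lemma cuts_eword (T : Q) : finer tow (fun T : Q => val T) ->
  cuts tow (eword (tow_edges Q tow_height tow_inj) T) (val T).
Proof.
move=> fine; have [w wP] := cuts_exists towP (KR_family Q) fine T.
by rewrite (eword_tow_edges wP).
Qed.

End TowerWords.

(** * The functor on morphisms *)

Section Objects.
Variables (R : realType) (X : sds_object R).

Lemma krs_finer n : finer (fun S : krs X n => val S) (fun T : krs X n.+1 => val T).
Proof.
split=> [T j jT|T x lx].
  have [|Z [S SP /(nthP set0)[i _ <-]] sub] := @krs_refines _ X n (nth set0 (val T) j).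
    by exists (val T); [exact: fsvalP|exact: mem_nth].
  by exists [` SP]%fset, i.
have : top (krs X n.+1) x by exists (val T) => //; exact: fsvalP.
by move=> /krs_top_all[S SP lS]; exists [` SP]%fset.
Qed.

Lemma bpath_cuts k l (T : krs X l) : (k <= l)%N ->
  cuts (fun S : krs X k => val S) (eword (bpath (P_ob X) k l) T) (val T).
Proof.
have diag n (S : krs X n) : cuts (fun S : krs X n => val S)
    (eword (bpath (P_ob X) n n) S) (val S).
  by rewrite bpath_id eword_diag /cuts /= cats0; apply: coarsens_refl.
elim: l T => [|l IH] T; first by rewrite leqn0 => /eqP E; subst k.
rewrite leq_eqVlt => /predU1P[E|]; first by subst k.
rewrite ltnS => kl; rewrite bpathS // eword_comp.
apply: (@cuts_flatten _ _ _ _ (fun S : krs X l => val S)) => [|S]; last exact: IH.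
apply: cuts_eword; [exact: KR_family|exact: krs_finer].
Qed.

Lemma dyn_inj : injective (@dyn _ X).
Proof. by have [_ [g [_ gK _]]] := em_homeo X; exact: can_inj gK. Qed.

Lemma dyn_surj (x : X) : exists y : X, x = dyn y.
Proof. by have [_ [g [_ _ gK]]] := em_homeo X; exists (g x); rewrite gK. Qed.

End Objects.

Section Morphisms.
Variables (R : realType) (X Y : sds_object R) (alpha : sds_hom X Y).

Definition ptower n (S : krs Y n) : seq (set X) := pre_tower alpha (val S).

Lemma nth_pre_tower t j : nth set0 (pre_tower alpha t) j = alpha @^-1` nth set0 t j.
Proof.
have [jt|tj] := ltnP j (size t); first by rewrite (nth_map set0).
by rewrite !nth_default ?size_map // preimage_set0.
Qed.

(** The preimages are non-empty because alpha is onto; one gets back from a base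
to a top because the homeomorphism of X is onto and that of Y injective. *)
Lemma pre_family n : tower_family (@dyn _ X) (@ptower n).
Proof.
have famY := KR_family (krs Y n).
have headE (S : krs Y n) x : head set0 (ptower S) x = head set0 (val S) (alpha x).
  by rewrite -!nth0 nth_pre_tower.
have lastE (S : krs Y n) x : last set0 (ptower S) x = last set0 (val S) (alpha x).
  by rewrite -!nth_last nth_pre_tower size_map.
split.
- move=> x; have [S [j Sj]] := tf_cover famY (alpha x).
  by exists S, j; rewrite nth_pre_tower.
- by move=> S S' j j' x; rewrite !nth_pre_tower; apply: (tf_disj famY).
- exact: pre_tower_height.
- move=> S j; rewrite size_map => /(tf_nonempty famY)[y Sy].
  have [x E] := sds_surj alpha y.
  by exists x; rewrite nth_pre_tower /preimage /= E.
- move=> S j x; rewrite !nth_pre_tower size_map /preimage /= sds_equiv.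
  exact: (tf_step famY).
- move=> S x; rewrite lastE => /(tf_return famY)[S' hS'].
  by exists S'; rewrite headE sds_equiv.
- move=> S x; rewrite headE => /(tf_return_inv famY)[S' [y [ly E]]].
  have [x' Ex] := dyn_surj x; exists S', x'; split=> //.
  rewrite lastE; suff -> : alpha x' = y by [].
  by apply: dyn_inj; rewrite -E Ex sds_equiv.
Qed.

Lemma cuts_pre_tower n (w : seq (krs Y n)) (t : seq (set Y)) :
  cuts (fun S : krs Y n => val S) w t -> cuts (@ptower n) w (pre_tower alpha t).
Proof. by move/(coarsens_preimage alpha); rewrite map_flatten -map_comp. Qed.

Lemma P_word_eq f n (T : krs X (f n)) (w : seq (krs Y n)) :
  cuts (@ptower n) w (val T) -> eword (P_edges alpha f n) T = w.
Proof. by apply: eword_tow_edges; apply: pre_family. Qed.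

Lemma admissible_finer f n : admissible alpha f ->
  finer (@ptower n) (fun T : krs X (f n) => val T).
Proof.
case=> _ _ _ ref tops; split=> [T j jT|T x lx].
  have [|Z [S /imfsetP[/= S' S'P ->] /(nthP set0)[i _ <-]] sub] := ref n (nth set0 (val T) j).
    by exists (val T); [exact: fsvalP|exact: mem_nth].
  by exists [` S'P]%fset, i.
have /tops[S /imfsetP[/= S' S'P ->] lS] : top (krs X (f n)) x.
  by exists (val T) => //; exact: fsvalP.
by exists [` S'P]%fset.
Qed.

Lemma P_word_cuts f n (T : krs X (f n)) : admissible alpha f ->
  cuts (@ptower n) (eword (P_edges alpha f n) T) (val T).
Proof.
move=> adm; apply: (@cuts_eword _ _ _ _ (@ptower n)); first exact: pre_family.
exact: admissible_finer.
Qed.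

(** Both sides cut the towers of level g m in X into preimages of towers of
level n in Y.  This gives at once the commutation relation of a premorphism
(f = g, m = n + 1) and the independence of the choice of f. *)
Lemma P_zigzag f g n m : admissible alpha f -> admissible alpha g ->
  (n <= m)%N -> (f n <= g m)%N ->
  eiso (bpath (P_ob Y) n m \oe P_edges alpha g m)
       (P_edges alpha f n \oe bpath (P_ob X) (f n) (g m)).
Proof.
move=> af ag nm fg; apply: eword_eiso => T; rewrite !eword_comp.
apply: (cuts_uniq (pre_family n) (t := val T)).
- exact: tf_nonempty (KR_family _) T.
- apply: cuts_flatten (P_word_cuts T ag) _ => S.
  by apply: cuts_pre_tower; apply: bpath_cuts.
- by apply: cuts_flatten (bpath_cuts T fg) _ => S; apply: P_word_cuts.
Qed.

Lemma krs0_size n (T : krs X n) : n = 0 -> size (val T) = 1.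
Proof.
move=> n0; subst n; have H t : t \in towers (krs X 0) -> size t = 1.
  by rewrite krs0 inE => /eqP ->.
exact: H (fsvalP T).
Qed.

Lemma P_premorphism f : admissible alpha f -> is_premorphism (P_edges alpha f).
Proof.
move=> af; case: (af) => f0 fm fu _ _.
have fin n := admissible_finer n af.
have srcP n (S : krs Y n) : exists e : P_edges alpha f n, src e = S.
  have [x Sx] := tf_nonempty (pre_family n) (tf_height (pre_family n) S).
  have [T [k Tx]] := tf_cover (KR_family (krs X (f n))) x.
  have Sx' : head set0 (ptower S) x by rewrite -nth0.
  have o := finer_occurs (pre_family n) (KR_family _) (fin n) Tx Sx'.
  by exists (exist _ (S, Tagged (fun T : krs X (f n) => 'I_(size (val T)))
    (Ordinal (nth_set0_lt Tx))) (asboolT o)).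
have rngP n (T : krs X (f n)) : exists e : P_edges alpha f n, rng e = T.
  have : (0 < size (eword (P_edges alpha f n) T))%N.
    case: (P_word_cuts T af) => sz _; move: sz.
    case: (eword _ _) => //= /esym/eqP.
    by rewrite eqn0Ngt kr_val_height.
  rewrite size_map; case E : (efiber _ _) => [//|e s] _.
  by exists e; apply/eqP; rewrite -mem_efiber E inE eqxx.
have gt0 n : (0 < #|P_edges alpha f n|)%N.
  have /card_gt0P[S _] := kr_card_gt0 (krs Y n).
  by have [e _] := srcP n S; apply/card_gt0P; exists e.
split=> //.
- have /card_gt0P[e _] := gt0 0; apply/eqP/fintype1P; exists e => e'.
  have pos0 (d : P_edges alpha f 0) : tow_pos d = 0.
    by rewrite /tow_pos; case: (tagged _) => k /=; rewrite krs0_size //; case: k.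
  have rE : tow_rng e = tow_rng e'.
    have : #|vtx (P_ob X) (f 0)| = 1 by rewrite f0 vtx0.
    by move/eqP/fintype1P => [v vE]; exact: etrans (vE _) (esym (vE _)).
  apply/(@ele_anti _ _ (P_edges alpha f 0)).
  by rewrite /= /tow_le !pos0 rE eqxx.
- move=> n; apply: eiso_trans (eiso_compl _ (eiso_sym (bpath1 _ n))) _.
  exact: P_zigzag.
Qed.

End Morphisms.

(** * Compactness *)

Lemma open_local (X : topologicalType) (U : set X) :
  (forall x, U x -> exists V, [/\ open V, V x & V `<=` U]) -> open U.
Proof.
move=> H; rewrite openE => x /H[V [oV Vx VU]].
by apply: filterS VU _; apply: open_nbhs_nbhs.
Qed.

(** The form in which compactness is used throughout; the sets [U n] will be the
points at which some property is already visible at level n. *)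
Lemma compact_exhaustion (X : topologicalType) (U : nat -> set X) :
  compact [set: X] -> (forall n, open (U n)) -> (forall n, U n `<=` U n.+1) ->
  (forall x, exists n, U n x) ->
  exists N, forall m, (N <= m)%N -> forall x, U m x.
Proof.
move=> /compact_near_coveringP cX oU incU covU.
have mono n m : (n <= m)%N -> U n `<=` U m.
  exact: (@homo_leq _ U (fun A B => A `<=` B) (fun A x h => h)
    (fun A B C h k x a => k x (h x a)) incU n m).
have [x _|N _ NP] := cX nat \oo (fun n x => U n x) _.
  have [n Unx] := covU x.
  exists (U n, [set m | (n <= m)%N]); first split=> /=.
  - by apply: open_nbhs_nbhs; split.
  - by exists n.
  - by move=> [y m] /= [Uy nm]; apply: mono nm _ Uy.
by exists N => m Nm x; apply: NP.
Qed.

Section Separation.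
Variables (R : realType) (X : sds_object R).

Lemma krs_local (x : X) (A : set X) : nbhs x A ->
  exists n (S : krs X n) j, nth set0 (val S) j x /\ nth set0 (val S) j `<=` A.
Proof.
have [_ /(_ x) B] := krs_basis X.
move=> /B[Z [[n _ [S SP /(nthP set0)[j _ <-]]] Sx] sub].
by exists n, [` SP]%fset, j.
Qed.

Lemma krs_cell_clopen n (S : krs X n) j : clopen (nth set0 (val S) j).
Proof.
have [lt|le] := ltnP j (size (val S)).
  apply: (kr_clopen (krP (krs X n))); exists (val S); first exact: fsvalP.
  exact: mem_nth.
by rewrite nth_default //; split; [exact: open0|exact: closed0].
Qed.

(** The cells form a basis of a Hausdorff topology. *)
Lemma krs_separate (x y : X) :
  (forall n (S : krs X n) j, nth set0 (val S) j x -> nth set0 (val S) j y) -> x = y.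
Proof.
move=> H; have [M [h [ch [g [cg hK _]]]]] := em_metrizable X.
apply: (can_inj hK); apply: (@metric_hausdorff _ M) => A B hA hB.
have [n [S [j [Sx sub]]]] := krs_local (ch x _ hA).
exists (h y); split; first exact: sub (H _ _ _ Sx).
exact: nbhs_singleton.
Qed.

Lemma krs_cell_succ n (S : krs X n) (T : krs X n.+1) j i x :
  nth set0 (val S) j x -> nth set0 (val T) i x ->
  nth set0 (val T) i `<=` nth set0 (val S) j.
Proof.
move=> Sx Tx; exact: (finer_cell (KR_family _) (@krs_finer _ X n) Tx Sx).
Qed.

Lemma krs_top_closed n : closed (top (krs X n)).
Proof.
rewrite -openC; apply: open_local => x ntx.
have [S [j Sx]] := tf_cover (KR_family (krs X n)) x.
exists (nth set0 (val S) j); split=> //; first by case: (krs_cell_clopen S j).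
move=> y Sy [S' S'P ly]; apply: ntx; exists S' => //.
rewrite -nth_last in ly; rewrite -nth_last.
have [E Ej] := tf_disj (KR_family (krs X n)) (S' := [` S'P]%fset) Sy ly.
by move: Sx; rewrite E Ej.
Qed.

Lemma krs_top_open n : open (top (krs X n)).
Proof.
apply: open_local => x [S SP]; rewrite -nth_last => lx.
exists (nth set0 S (size S).-1); split=> //.
  by case: (krs_cell_clopen [` SP]%fset (size S).-1).
by move=> y ly; exists S => //; rewrite -nth_last.
Qed.

Lemma top_inter n (x : X) : (forall m, (n <= m)%N -> top (krs X m) x) -> x = @pt _ X.
Proof.
move=> H; have : [set @pt _ X] x; last by [].
rewrite -krs_top_inter => m _.
have dec k l : (k <= l)%N -> top (krs X l) `<=` top (krs X k).
  elim: l => [|l IH]; first by rewrite leqn0 => /eqP ->.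
  rewrite leq_eqVlt => /predU1P[->//|]; rewrite ltnS => /IH.
  by apply: subset_trans; apply: krs_top_all.
exact: dec (leq_maxr n m) _ (H _ (leq_maxl n m)).
Qed.

End Separation.

Section Admissible.
Variables (R : realType) (X Y : sds_object R) (alpha : sds_hom X Y).

Lemma pre_cells n Z : cells (pre_partition alpha (krs Y n)) Z <->
  exists (S : krs Y n) j, (j < size (val S))%N /\ Z = alpha @^-1` nth set0 (val S) j.
Proof.
split=> [[S /imfsetP[/= S' S'P ->] /(nthP set0)[j]]|[S [j [jS ->]]]].
  by rewrite size_map => jS <-; exists [` S'P]%fset, j; rewrite nth_pre_tower.
exists (pre_tower alpha (val S)); first by apply: in_imfset; exact: fsvalP.
by rewrite -nth_pre_tower mem_nth // size_map.
Qed.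

Lemma pre_top n : top (pre_partition alpha (krs Y n)) = alpha @^-1` top (krs Y n).
Proof.
apply/seteqP; split=> x.
  move=> [S /imfsetP[/= S' S'P ->]]; rewrite -nth_last nth_pre_tower size_map nth_last.
  by exists S'.
move=> [S SP lS]; exists (pre_tower alpha S); first exact: in_imfset.
by rewrite -nth_last nth_pre_tower size_map nth_last.
Qed.

(** The union of the cells of level m that lie in some preimage of a cell is
open and increases with m. *)
Lemma eventually_refines n : exists N, forall m, (N <= m)%N ->
  refines (pre_partition alpha (krs Y n)) (krs X m).
Proof.
pose U m : set X := [set x | exists (T : krs X m) i (S : krs Y n) j,
  nth set0 (val T) i x /\ nth set0 (val T) i `<=` alpha @^-1` nth set0 (val S) j].
have [||x|N NP] := @compact_exhaustion X U (@em_compact _ X).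
- move=> m; apply: open_local => x [T [i [S [j [Tx sub]]]]].
  exists (nth set0 (val T) i); split=> //; first by case: (krs_cell_clopen T i).
  by move=> y Ty; exists T, i, S, j.
- move=> m x [T [i [S [j [Tx sub]]]]].
  have [T' [i' Tx']] := tf_cover (KR_family (krs X m.+1)) x.
  exists T', i', S, j; split=> //.
  exact: subset_trans (krs_cell_succ Tx Tx') sub.
- have [S [j Sx]] := tf_cover (pre_family alpha n) x.
  rewrite nth_pre_tower in Sx.
  have [|m [T [i [Tx sub]]]] := @krs_local _ X x (alpha @^-1` nth set0 (val S) j).
    apply: (@sds_cont _ _ _ alpha x (nth set0 (val S) j)).
    by apply: open_nbhs_nbhs; split=> //; case: (krs_cell_clopen S j).
  by exists m, T, i, S, j.
exists N => m Nm Z [T TP /(nthP set0)[i iT <-]].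
have [x Tx] := tf_nonempty (KR_family (krs X m)) (S := [` TP]%fset) iT.
have [T' [i' [S [j [Tx' sub]]]]] := NP m Nm x.
have [E Ei] := tf_disj (KR_family (krs X m)) (S := [` TP]%fset) Tx Tx'; subst T' i'.
exists (alpha @^-1` nth set0 (val S) j) => //.
by apply/pre_cells; exists S, j; split=> //; apply: nth_set0_lt (sub _ Tx).
Qed.

(** Away from the base point x lies outside the tops of large levels, and the
base point lies in the preimage of the top. *)
Lemma eventually_top n : exists N, forall m, (N <= m)%N ->
  top (krs X m) `<=` top (pre_partition alpha (krs Y n)).
Proof.
rewrite pre_top.
(* Level m.+1, as the tops that intersect in the base point are those of
   positive level. *)
pose U m : set X := ~` top (krs X m.+1) `|` alpha @^-1` top (krs Y n).
have [m|m x|x|N NP] := @compact_exhaustion X U (@em_compact _ X).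
- apply: openU; first by rewrite openC; exact: krs_top_closed.
  by move/continuousP: (@sds_cont _ _ _ alpha); apply; exact: krs_top_open.
- by case=> [nt|t]; [left=> /(@krs_top_all _ X)/nt|right].
- have [E|ne] := pselect (x = @pt _ X).
    by exists 0; right; rewrite E /preimage /= sds_pt; exact: (kr_pt (krP _)).
  apply: contrapT => H; apply: ne.
  have : [set @pt _ X] x by rewrite -krs_top_inter => -[//|m] _; apply: contrapT => nt;
    apply: H; exists m; left.
  by [].
by exists N.+1 => -[//|m] Nm x tx; case: (NP m Nm x).
Qed.

Lemma admissible_exists : exists f, admissible alpha f.
Proof.
have [a aP] := choice eventually_refines; have [b bP] := choice eventually_top.
pose f := fix f n := if n is n'.+1
  then maxn (f n').+1 (maxn (a n'.+1) (b n'.+1)) else 0.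
have fS n : (f n < f n.+1)%N by rewrite /= leq_maxl.
have fge n : (n <= f n)%N by elim: n => // n IH; exact: leq_ltn_trans IH (fS n).
have triv (Z : sds_object R) z : top (krs Z 0) z.
  by rewrite krs0; exists [:: [set: Z]]; rewrite ?inE.
exists f; split=> //.
- by move=> n; exact: ltnW (fS n).
- by move=> N; exists N.
- case=> [|n]; last by apply: aP; rewrite /= !leq_max leqnn orbT.
  move=> Z _; exists (alpha @^-1` [set: Y]) => //; apply/pre_cells.
  have S0P : [:: [set: Y]] \in towers (krs Y 0) by rewrite krs0 inE.
  by exists [` S0P]%fset, 0.
- case=> [|n]; last by apply: bP; rewrite /= !leq_max leqnn !orbT.
  by move=> x _; rewrite pre_top; exact: triv.
Qed.

End Admissible.

(** * Functoriality and faithfulness *)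

Section Value.
Variables (R : realType) (X Y : sds_object R) (alpha : sds_hom X Y).

Lemma P_indep f g (af : admissible alpha f) (ag : admissible alpha g) :
  pequiv (Premorphism (P_premorphism af)) (Premorphism (P_premorphism ag)).
Proof.
have H f1 g1 (af1 : admissible alpha f1) (ag1 : admissible alpha g1) :
    plinks (Premorphism (P_premorphism af1)) (Premorphism (P_premorphism ag1)).
  move=> n; have [M MP] := pm_unbounded (P_premorphism ag1) (f1 n).
  have le m : (maxn n M <= m)%N -> (n <= m)%N /\ (f1 n <= g1 m)%N.
    rewrite geq_max => /andP[nm Mm]; split=> //; apply: leq_trans MP _.
    exact: (@pidx_mono _ _ (Premorphism (P_premorphism ag1))).
  exists (maxn n M); first exact: le.
  by move=> m /le[nm fg]; apply: P_zigzag.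
by apply/pequivP; split; apply: H.
Qed.

Definition P_mor : obd_hom (P_ob Y) (P_ob X) :=
  obd_class (Premorphism (P_premorphism (projT2 (cid (admissible_exists alpha))))).

Lemma P_morE f (af : admissible alpha f) :
  P_mor = obd_class (Premorphism (P_premorphism af)).
Proof. by apply/obd_classP; apply: P_indep. Qed.

Lemma P_mor_value : P_value alpha P_mor.
Proof.
split; first exact: admissible_exists.
by move=> f af; exists (P_premorphism af); apply: P_morE.
Qed.

End Value.

Section Functor.
Variable R : realType.

Lemma pre_tower_id (X : sds_object R) t : pre_tower (sds_id X) t = t.
Proof. by rewrite /pre_tower -[RHS]map_id; apply: eq_map. Qed.

Lemma admissible_id (X : sds_object R) : admissible (sds_id X) id.
Proof.
split=> // [N|n Z [T TP /(nthP set0)[j jT <-]]|n x].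
- by exists N.
- exists (nth set0 T j) => //; apply/pre_cells.
  by exists [` TP]%fset, j.
- by rewrite pre_top.
Qed.

Lemma P_mor_id (X : sds_object R) : P_mor (sds_id X) = obd_class (pid (P_ob X)).
Proof.
rewrite (P_morE (admissible_id X)); apply/obd_classP; apply: pequiv_iso => n.
apply: eword_eiso => T; rewrite eword_diag.
apply: (@P_word_eq _ _ _ (sds_id X) id n T).
by rewrite /cuts /= cats0 /ptower pre_tower_id; apply: coarsens_refl.
Qed.

Variables (X Y Z : sds_object R) (beta : sds_hom Y Z) (alpha : sds_hom X Y).

Lemma sds_comp_map : sds_map (sds_comp beta alpha) = beta \o alpha.
Proof. by apply/funext => x; rewrite sds_compE. Qed.

Lemma pre_tower_comp t :
  pre_tower (sds_comp beta alpha) t = pre_tower alpha (pre_tower beta t).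
Proof. by rewrite /pre_tower -map_comp sds_comp_map; apply: eq_map. Qed.

Lemma admissible_comp a b : admissible beta a -> admissible alpha b ->
  admissible (sds_comp beta alpha) (b \o a).
Proof.
move=> [a0 am au ar at_] [b0 bm bu br bt].
have bmono := @homo_leq _ b leq leqnn leq_trans bm.
split=> /=; first by rewrite a0.
- by move=> n; apply: bmono.
- move=> N; have [m mP] := bu N; have [n nP] := au m.
  by exists n; apply: leq_trans mP (bmono _ _ nP).
- move=> n U /br[V /pre_cells[S [j [jS ->]]] UV].
  have [|W /pre_cells[S' [j' [jS' ->]]] sub] := ar n (nth set0 (val S) j).
    by exists (val S); [exact: fsvalP|exact: mem_nth].
  exists (sds_comp beta alpha @^-1` nth set0 (val S') j').
    by apply/pre_cells; exists S', j'.
  by move=> x /UV/sub; rewrite sds_comp_map.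
- move=> n x /bt; rewrite !pre_top => /at_; rewrite pre_top.
  by rewrite sds_comp_map.
Qed.

Lemma P_mor_comp :
  P_mor (sds_comp beta alpha) = obd_comp (P_mor alpha) (P_mor beta).
Proof.
have [a aP] := admissible_exists beta; have [b bP] := admissible_exists alpha.
rewrite (P_morE aP) (P_morE bP) obd_compE (P_morE (admissible_comp aP bP)).
apply/obd_classP; apply: pequiv_iso => n; apply: eword_eiso => T.
rewrite eword_comp /=; apply: P_word_eq.
apply: cuts_flatten (@P_word_cuts _ _ _ alpha b (a n) T bP) _ => S.
have := coarsens_preimage alpha (P_word_cuts S aP).
rewrite map_flatten -map_comp /cuts; congr (coarsens _ (flatten _)).
by apply: eq_map => S'; rewrite /ptower pre_tower_comp.
Qed.

End Functor.

Section Faithful.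
Variables (R : realType) (X Y : sds_object R).

(** The word w below is at once an alpha-word and a beta-word of the tower of x,
so that its cell at the height of x contains both alpha x and beta x. *)
Lemma P_mor_inj (alpha beta : sds_hom X Y) : P_mor alpha = P_mor beta -> alpha = beta.
Proof.
have [f af] := admissible_exists alpha; have [g ag] := admissible_exists beta.
rewrite (P_morE af) (P_morE ag) => /obd_classP/pequivP[link _].
apply: sds_hom_eq => x; apply: krs_separate => n S j Sx.
have [M [nM fg] /(_ M (leqnn M)) iso] := link n; rewrite /= in fg.
have [T [k Tx]] := tf_cover (KR_family (krs X (g M))) x.
have E := eiso_eword iso T; rewrite !eword_comp in E.
set w := flatten _ in E.
have cb : cuts (ptower beta (n := n)) w (val T).
  apply: cuts_flatten (P_word_cuts T ag) _ => S'.
  by apply: cuts_pre_tower; apply: bpath_cuts.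
have ca : cuts (ptower alpha (n := n)) w (val T).
  by rewrite E; apply: cuts_flatten (bpath_cuts T fg) _ => S'; apply: P_word_cuts.
have cell (gamma : sds_hom X Y) : cuts (ptower gamma (n := n)) w (val T) ->
    nth set0 (flatten (map (fun S : krs Y n => val S) w)) k (gamma x).
  move=> [_ /(_ k x Tx)]; rewrite -[map _ w]/(map (map _ \o _) w) map_comp -map_flatten.
  by rewrite nth_pre_tower.
have := cell _ ca; have := cell _ cb => bx ax.
have [S' [i [_ Ei _]]] := nth_flatten_parallel set0 set0
  (fun S => erefl (size (val S))) (nth_set0_lt ax).
rewrite Ei in ax bx; have [-> ->] := tf_disj (KR_family (krs Y n)) Sx ax.
exact: bx.
Qed.

End Faithful.

(** * Fullness *)

Section Full.
Variables (R : realType) (X Y : sds_object R).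
Variable p : premorphism (P_ob Y) (P_ob X).
Let f := pidx p.

(** The itinerary through the cells of level n in Y that the points of T have to
follow under a map inducing the premorphism. *)
Definition code n (T : krs X (f n)) : seq (set Y) :=
  flatten (map (fun S : krs Y n => val S) (eword (pedge p n) T)).

Lemma size_bpath0 (Z : sds_object R) k l (T : krs Z l) : k = 0 -> (k <= l)%N ->
  size (eword (bpath (P_ob Z) k l) T) = size (val T).
Proof.
move=> k0 kl; have [<- _] := bpath_cuts T kl.
rewrite -[in LHS](flatten_seq1 (eword _ _)); apply: size_flatten_map => S.
by rewrite (krs0_size S k0).
Qed.

Lemma size_eword0 v : size (eword (pedge p 0) v) = 1.
Proof.
have c1 := pm_card0 (premorphismP p).
rewrite size_map; apply/eqP; rewrite eqn_leq; apply/andP; split.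
  by rewrite -(card_uniqP (efiber_uniq (pedge p 0) v)) -c1 max_card.
have [e <-] := pm_rng (premorphismP p) v.
by rewrite -has_predT; apply/hasP; exists e; rewrite ?mem_efiber.
Qed.

(** At level 0 the only tower has height 1, so a path from level 0 to a tower is
a level of that tower; the commutation relation from 0 to n then equates
heights. *)
Lemma size_code n (T : krs X (f n)) : size (code T) = size (val T).
Proof.
have f0 : f 0 = 0 := pm0 (premorphismP p).
have := eiso_eword (pm_path p (leq0n n)) T; rewrite !eword_comp => /(congr1 size).
rewrite (@size_flatten_map _ _ _ _ (fun S : krs Y n => val S)) => [->|S]; last first.
  exact: size_bpath0.
rewrite (@size_flatten_map _ _ _ _ (fun S : krs X (f 0) => [:: S])) => [|S]; last first.
  exact: size_eword0.
by rewrite flatten_seq1; apply: size_bpath0; rewrite // f0.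
Qed.

Lemma code_cell n (T : krs X (f n)) j : (j < size (val T))%N ->
  exists (S : krs Y n) i, (i < size (val S))%N /\ nth set0 (code T) j = nth set0 (val S) i.
Proof.
rewrite -size_code => /(nth_flatten_parallel set0 set0
  (fun S : krs Y n => erefl (size (val S))))[S [i [iS E _]]].
by exists S, i.
Qed.

(** Cut T' into towers of level n in Y in the two ways that the commutation
relation identifies: through level n.+1 in Y, which gives cells containing those of the itinerary of
T', and through level f n in X, which gives the itineraries of the towers T. *)
Lemma code_succ n (T : krs X (f n)) (T' : krs X (f n.+1)) j j' x :
  nth set0 (val T) j x -> nth set0 (val T') j' x ->
  nth set0 (code T') j' `<=` nth set0 (code T) j.
Proof.
move=> Tx Tx'; have := eiso_eword (pm_comm (premorphismP p) n) T'.
rewrite !eword_comp; set v := eword (bpath (P_ob X) _ _) T' => E.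
have [_ sub] : cuts (fun S : krs Y n => val S)
    (flatten (map (eword (bedge (P_ob Y) n)) (eword (pedge p n.+1) T'))) (code T').
  apply: cuts_flatten (coarsens_refl _) _ => S.
  by apply: cuts_eword; [exact: KR_family|exact: krs_finer].
apply: subset_trans (sub j') _; rewrite E.
have [szv subv] := bpath_cuts T' (pm_mono (premorphismP p) n).
have Tv := subv j' x Tx'.
have -> : flatten (map (fun S : krs Y n => val S) (flatten (map (eword (pedge p n)) v)))
    = flatten (map (@code n) v).
  by elim: (v) => //= i s IH; rewrite map_cat flatten_cat IH.
have szE (T0 : krs X (f n)) : size (val T0) = size (code T0) by rewrite size_code.
have [T0 [j0 [_ E1 E2]]] := nth_flatten_parallel set0 set0 szE (nth_set0_lt Tv).
rewrite E1 in Tv; rewrite E2.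
by have [<- <-] := tf_disj (KR_family (krs X (f n))) Tx Tv.
Qed.

Definition coded (x : X) (y : Y) : Prop := forall n (T : krs X (f n)) j,
  nth set0 (val T) j x -> nth set0 (code T) j y.

Lemma code_clopen n (T : krs X (f n)) j : clopen (nth set0 (code T) j).
Proof.
have [lt|le] := ltnP j (size (val T)).
  by have [S [i [_ ->]]] := code_cell lt; apply: krs_cell_clopen.
by rewrite nth_default ?size_code //; split; [exact: open0|exact: closed0].
Qed.

(** The cells prescribed for x are closed, non-empty and decreasing. *)
Lemma coded_exists x : exists y, coded x y.
Proof.
apply: contrapT => nex.
pose U n : set Y := [set y | exists (T : krs X (f n)) j,
  nth set0 (val T) j x /\ ~ nth set0 (code T) j y].
have [||y|N NP] := @compact_exhaustion Y U (@em_compact _ Y).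
- move=> n; apply: open_local => y [T [j [Tx ny]]].
  exists (~` nth set0 (code T) j); split=> //.
    by rewrite openC; case: (code_clopen T j).
  by move=> z nz; exists T, j.
- move=> n y [T [j [Tx ny]]].
  have [T' [j' Tx']] := tf_cover (KR_family (krs X (f n.+1))) x.
  by exists T', j'; split=> // /(code_succ Tx Tx').
- apply: contrapT => nU; apply: nex; exists y => n T j Tx.
  by apply: contrapT => ny; apply: nU; exists n, T, j.
have [T [j Tx]] := tf_cover (KR_family (krs X (f N))) x.
have [S [i [iS E]]] := code_cell (nth_set0_lt Tx).
have [y Sy] := tf_nonempty (KR_family (krs Y N)) iS.
have [T' [j' [Tx' []]]] := NP N (leqnn N) y.
by have [<- <-] := tf_disj (KR_family (krs X (f N))) Tx Tx'; rewrite E.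
Qed.

Section Decoded.
Variable a : X -> Y.
Hypothesis aP : forall x, coded x (a x).

Lemma code_locate n (S : krs Y n) i x : nth set0 (val S) i (a x) ->
  exists (T : krs X (f n)) j, nth set0 (val T) j x /\ nth set0 (code T) j = nth set0 (val S) i.
Proof.
move=> Sx; have [T [j Tx]] := tf_cover (KR_family (krs X (f n))) x.
exists T, j; split=> //; have := aP Tx.
have [S' [i' [_ ->]]] := code_cell (nth_set0_lt Tx) => Sx'.
by have [-> ->] := tf_disj (KR_family (krs Y n)) Sx Sx'.
Qed.

Lemma decoded_continuous : continuous a.
Proof.
move=> x A /krs_local[n [S [i [Sx sub]]]].
have [T [j [Tx E]]] := code_locate Sx.
suff : nbhs x (nth set0 (val T) j).
  by apply: filterS => z Tz; apply: sub; rewrite -E; apply: aP.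
by apply: open_nbhs_nbhs; split=> //; case: (krs_cell_clopen T j).
Qed.

Lemma code_top n (T : krs X (f n)) y : last set0 (code T) y -> top (krs Y n) y.
Proof.
rewrite -nth_last => Ty; have lt := nth_set0_lt Ty.
have [S [i [iS E N]]] := nth_flatten_next (@kr_val_height _ _ _ (krs Y n)) lt.
have ei : i.+1 = size (val S).
  by case: N => [[_]|[]//]; rewrite prednK ?ltnn // (leq_ltn_trans _ lt).
exists (val S); first exact: fsvalP.
by rewrite -nth_last -ei /= -E.
Qed.

Lemma code_base n (T : krs X (f n)) y : head set0 (code T) y -> base (krs Y n) y.
Proof.
rewrite /code; case: (eword _ _) => [[]|S w] /=.
rewrite -nth0 nth_cat kr_val_height nth0 => Sy.
by exists (val S); first exact: fsvalP.
Qed.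

Lemma decoded_top n x : top (krs X (f n)) x -> top (krs Y n) (a x).
Proof.
move=> [T TP]; rewrite -nth_last => Tx; apply: (@code_top n [` TP]%fset).
by rewrite -nth_last size_code; apply: aP.
Qed.

Lemma decoded_pt : a (@pt _ X) = @pt _ Y.
Proof.
by apply: (@top_inter _ Y 0) => n _; apply: decoded_top; exact: (kr_pt (krP _)).
Qed.

(** The second case occurs when the image cell of x is the top of its tower:
the next cell of the itinerary is then the bottom of some tower, also when x is
at the top of T and the itinerary ends. *)
Lemma decoded_step n x :
  (exists (S : krs Y n) i, nth set0 (val S) i (a (dyn x)) /\ nth set0 (val S) i (dyn (a x)))
  \/ base (krs Y n) (a (dyn x)) /\ base (krs Y n) (dyn (a x)).
Proof.
have famX := KR_family (krs X (f n)); have famY := KR_family (krs Y n).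
have topbase y : top (krs Y n) y -> base (krs Y n) (dyn y).
  by move=> ty; rewrite -(kr_top (krP (krs Y n))); exists y.
have [T [j Tx]] := tf_cover famX x.
have [lt|le] := ltnP j.+1 (size (val T)); last first.
  have Tl : last set0 (val T) x.
    by apply/(last_height famX Tx)/eqP; rewrite eqn_leq le (nth_set0_lt Tx).
  right; split; last first.
    by apply: topbase; apply: decoded_top; exists (val T) => //; exact: fsvalP.
  have [T' hT'] := tf_return famX Tl; apply: (@code_base n T').
  by rewrite -nth0; apply: aP; rewrite nth0.
have aTx := aP Tx; have aTx' := aP (tf_step famX lt Tx).
have [S [i [iS E N]]] := nth_flatten_next (@kr_val_height _ _ _ (krs Y n)) (nth_set0_lt aTx).
rewrite -/(code T) in E N; rewrite E in aTx.
case: N => [[iS' _ E']|[ei N]].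
  left; exists S, i.+1; rewrite -E'; split=> //.
  by rewrite E'; apply: (tf_step famY).
right; split; last first.
  apply: topbase; exists (val S); first exact: fsvalP.
  by rewrite -nth_last -ei.
case: N => [es|[S' E']]; first by move: lt; rewrite es size_code ltnn.
by exists (val S'); [exact: fsvalP|rewrite -nth0 -E'].
Qed.

(** If the first case of [decoded_step] fails at one level, it fails at all later
ones, so both points are in every later base and hence are the image of y_0. *)
Lemma decoded_equiv x : a (dyn x) = dyn (a x).
Proof.
pose C n := exists (S : krs Y n) i,
  nth set0 (val S) i (a (dyn x)) /\ nth set0 (val S) i (dyn (a x)).
have [allC|/existsNP[n nC]] := pselect (forall n, C n).
  apply: krs_separate => n S i Si; have [S' [i' [h1 h2]]] := allC n.
  by have [-> ->] := tf_disj (KR_family (krs Y n)) Si h1.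
have down m : C m.+1 -> C m.
  move=> [S' [i' [h1 h2]]]; have [S [i Si]] := tf_cover (KR_family (krs Y m)) (a (dyn x)).
  by exists S, i; split=> //; apply: (krs_cell_succ Si h1).
have nCm m : (n <= m)%N -> ~ C m.
  elim: m => [|m IH]; first by rewrite leqn0 => /eqP <-.
  by rewrite leq_eqVlt => /predU1P[<- //|]; rewrite ltnS => /IH nm /down.
have pre z : (forall m, (n <= m)%N -> base (krs Y m) z) -> z = dyn (@pt _ Y).
  move=> H; have [z' Ez] := dyn_surj z; rewrite Ez; congr dyn.
  apply: (@top_inter _ Y n) => m /H; rewrite -(kr_top (krP (krs Y m))) => -[z'' tz].
  by rewrite Ez => /dyn_inj <-.
have B m : (n <= m)%N -> base (krs Y m) (a (dyn x)) /\ base (krs Y m) (dyn (a x)).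
  by move=> /nCm nm; case: (decoded_step m x).
by apply: etrans (pre _ _) (esym (pre _ _)) => m /B[].
Qed.

(** If y were not attained, then at a single level N every x would have an
itinerary cell that misses y; but the tower through y is the source of an edge
of F_N, so its cells do occur in an itinerary. *)
Lemma decoded_surj y : exists x, a x = y.
Proof.
apply: contrapT => nex.
pose U n : set X := [set x | exists (T : krs X (f n)) j,
  nth set0 (val T) j x /\ ~ nth set0 (code T) j y].
have [||x|N NP] := @compact_exhaustion X U (@em_compact _ X).
- move=> n; apply: open_local => x [T [j [Tx ny]]].
  exists (nth set0 (val T) j); split=> //; first by case: (krs_cell_clopen T j).
  by move=> z nz; exists T, j.
- move=> n x [T [j [Tx ny]]].
  have [T' [j' Tx']] := tf_cover (KR_family (krs X (f n.+1))) x.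
  by exists T', j'; split=> // /(code_succ Tx Tx').
- apply: contrapT => nU; apply: nex; exists x; apply: krs_separate => n S i Sx.
  have [T [j [Tx E]]] := code_locate Sx; rewrite -E.
  by apply: contrapT => ny; apply: nU; exists n, T, j.
have [S [i Sy]] := tf_cover (KR_family (krs Y N)) y.
have [e eS] := pm_src (premorphismP p) S.
have Sw : S \in eword (pedge p N) (rng e) by rewrite -eS; exact: mem_eword.
have iw : (index S (eword (pedge p N) (rng e)) < size (eword (pedge p N) (rng e)))%N.
  by rewrite index_mem.
have [|k [kl E]] := @nth_flatten_mem _ _ (fun S : krs Y N => val S) S _ _ i iw.
  by rewrite nth_index // (nth_set0_lt Sy).
rewrite nth_index // in E; rewrite -/(code (rng e)) size_code in kl.
have [x Tx] := tf_nonempty (KR_family (krs X (f N))) kl.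
have [T' [j' [Tx' []]]] := NP N (leqnn N) x.
have [<- <-] := tf_disj (KR_family (krs X (f N))) Tx Tx'.
by rewrite /code E.
Qed.

Definition decoded_hom : sds_hom X Y :=
  SDSHom decoded_continuous decoded_equiv decoded_pt decoded_surj.

Lemma decoded_admissible : admissible decoded_hom f.
Proof.
split; try by case: (premorphismP p).
- move=> n Z [T TP /(nthP set0)[j jT <-]].
  have [S [i [iS E]]] := code_cell (T := [` TP]%fset) jT.
  exists (decoded_hom @^-1` nth set0 (val S) i); first by apply/pre_cells; exists S, i.
  by rewrite -E => x Tx; exact: aP.
- by move=> n x tx; rewrite pre_top; exact: decoded_top.
Qed.

(** The itinerary of T was read off the F_n-word of T, so this word cuts T into
preimages of towers, and the word of T in P(alpha) is the only one to do so. *)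
Lemma P_mor_decoded : P_mor decoded_hom = obd_class p.
Proof.
rewrite (P_morE decoded_admissible); apply/obd_classP.
have -> : p = Premorphism (premorphismP p) by case: (p).
apply: pequiv_iso => n; apply: eword_eiso => T; apply: P_word_eq.
have := size_code T; rewrite /code -(size_map (preimage a)) map_flatten -map_comp => sz.
split=> // j x Tx.
have := aP Tx; rewrite /code.
rewrite -[nth _ _ _ _]/((decoded_hom @^-1` _) x) -nth_pre_tower.
by rewrite /pre_tower map_flatten -map_comp.
Qed.

End Decoded.

Lemma P_mor_surj : exists alpha : sds_hom X Y, P_mor alpha = obd_class p.
Proof.
by have [a aP] := choice coded_exists; exists (decoded_hom aP); apply: P_mor_decoded.
Qed.

End Full.

Theorem theorem3p8 (R : realType) :
  exists P : contrafunctor (C := SDS R) (D := OBD) (@P_ob R),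
    (forall (X Y : SDS R) (alpha : hom X Y), P_value alpha (fmap P alpha)) /\
    full P /\ faithful P.
Proof.
exists (@ContraFunctor (SDS R) OBD (@P_ob R) (@P_mor R) (@P_mor_id R)
  (fun A B B' g f => @P_mor_comp R A B B' g f)); split; [|split].
- by move=> X Y alpha; apply: P_mor_value.
- move=> X Y h; have [alpha E] := P_mor_surj (obd_repr h).
  by exists alpha; rewrite /= E obd_reprK.
- by move=> X Y alpha beta; apply: P_mor_inj.
Qed.
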